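(* Let $\mathcal{S}$ be a smooth closed surface embedded in $\mathbb{R}^d$, let $\Omega \subset \mathbb{R}^d$ be a neighborhood of $\mathcal{S}$ on which the closest point function $\mathrm{cp}$ is defined, and let $0<\varepsilon \ll 1$. (Existence and uniqueness.) For every $C^2$ eigenfunction $u:\mathcal{S}\to\mathbb{R}$ of the surface problem $$-\Delta_{\mathcal{S}} u(x) = \lambda u(x), \quad x\in\mathcal{S},$$ with eigenvalue $\lambda < \frac{2d}{\varepsilon^2}$, there exists a unique eigenfunction $v:\Omega\to\mathbb{R}$ of the embedded problem $$-\Delta^{\#}_{\varepsilon} v(x) = \lambda v(x), \quad x\in\Omega,$$ with eigenvalue $\lambda$ which agrees with $u$ on $\mathcal{S}$. The eigenfunction $v$ is given by $$v(x) = \frac{\Delta(u(\mathrm{cp}(x))) + \frac{2d}{\varepsilon^2}\, u(\mathrm{cp}(x))}{-\lambda + \frac{2d}{\varepsilon^2}}, \quad x \in \Omega.$$ (Converse.) For every eigenfunction $v:\Omega\to\mathbb{R}$ of the embedded problem $-\Delta^{\#}_{\varepsilon} v = \lambda v$ on $\Omega$ with eigenvalue $\lambda$, the restriction of $v$ to $\mathcal{S}$ is an eigenfunction of the surface problem $-\Delta_{\mathcal{S}} u = \lambda u$ on $\mathcal{S}$ with eigenvalue $\lambda$.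
   Context: $\Delta_{\mathcal{S}}$ is the Laplace--Beltrami operator on $\mathcal{S}$ and $\Delta$ is the standard Laplacian in $\mathbb{R}^d$. Closed means compact without boundary; the surface may have any codimension. For $x$ in the neighborhood $\Omega$ of $\mathcal{S}$, $\mathrm{cp}(x)\in\mathcal{S}$ denotes the point of $\mathcal{S}$ closest to $x$, assumed well-defined on $\Omega$; in particular $\mathrm{cp}(x)=x$ for $x\in\mathcal{S}$. For a function $w$ defined on $\mathcal{S}$ (or on $\Omega$), $\Delta(w(\mathrm{cp}(x)))$ denotes the Laplacian in $\mathbb{R}^d$ of the function $x\mapsto w(\mathrm{cp}(x))$ on $\Omega$. For $v:\Omega\to\mathbb{R}$ (with $x\mapsto v(\mathrm{cp}(x))$ regular enough for its Laplacian to make sense), the operator $\Delta^{\#}_{\varepsilon}$ is defined by $$\Delta^{\#}_{\varepsilon} v(x) := \Delta(v(\mathrm{cp}(x))) - \frac{2d}{\varepsilon^2}\big[v(x) - v(\mathrm{cp}(x))\big].$$ Here $\varepsilon$ is a fixed small positive parameter (no quantitative smallness is specified). Eigenfunction and eigenvalue have their usual meaning for the stated equations.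
   Formalization: In the converse, the restriction of v is shown to solve the surface equation for every λ, but to be nonzero (an eigenfunction) only when λ ≠ 2d/ε²: at λ = 2d/ε² any nonzero v vanishing on S solves the embedded problem and restricts to zero. *)

(* Defs.v *)
From HB Require Import structures.
From mathcomp Require Import all_boot all_order all_algebra.
From mathcomp Require Import all_classical all_reals all_analysis.

Set Implicit Arguments.
Unset Strict Implicit.
Unset Printing Implicit Defensive.

Import Order.TTheory GRing.Theory Num.Theory.
Import numFieldNormedType.Exports.

Local Open Scope classical_set_scope.
Local Open Scope ring_scope.

(* Points of R^n are row vectors 'rV[R]_n.  Functions whose mathematical domain is a subset of R^n are total
   functions of which only the values on that subset are ever used. *)

Section Calculus.
Variables (R : realType) (n : nat).

Definition partial (V : normedModType R) (i : 'I_n) (f : 'rV[R]_n -> V) :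
    'rV[R]_n -> V :=
  fun x => 'D_(delta_mx 0 i) f x.

(* [Ck m U f], for an open set U: all the iterated partial derivatives of f of
   order at most m exist and are continuous at every point of U. *)
Fixpoint Ck (V : normedModType R) (m : nat) (U : set 'rV[R]_n)
    (f : 'rV[R]_n -> V) : Prop :=
  (forall x, U x -> {for x, continuous f}) /\
  if m is m'.+1 then
    forall i : 'I_n,
      (forall x, U x -> derivable f x (delta_mx 0 i)) /\
      Ck m' U (partial i f)
  else True.

Definition smooth (V : normedModType R) (U : set 'rV[R]_n)
    (f : 'rV[R]_n -> V) : Prop :=
  forall m, Ck m U f.

Definition laplacian (f : 'rV[R]_n -> R) (x : 'rV[R]_n) : R :=
  \sum_(i < n) partial i (partial i f) x.

(* The norm that the library puts on 'rV[R]_n is the sup norm; it induces the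
   usual topology, but distances must be measured with the Euclidean norm. *)
Definition enorm (x : 'rV[R]_n) : R := Num.sqrt (\sum_(i < n) x 0 i ^+ 2).

End Calculus.

Section Surface.
Variables (R : realType) (d k : nat).
Implicit Types (S : set 'rV[R]_d) (U : set 'rV[R]_k)
  (phi : 'rV[R]_k -> 'rV[R]_d).

(* The k x d matrix whose i-th row is the tangent vector d_i phi (y). *)
Definition tangent_frame phi (y : 'rV[R]_k) : 'M[R]_(k, d) :=
  \matrix_(i < k, j < d) partial i phi y 0 j.

(* g_ij = <d_i phi, d_j phi>, the metric induced by the ambient space. *)
Definition metric phi (y : 'rV[R]_k) : 'M[R]_k :=
  tangent_frame phi y *m (tangent_frame phi y)^T.

(* A smooth injective immersion of an open set U of R^k which is a
   homeomorphism onto a relatively open subset of S; the last clause (phi maps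
   open subsets of U to relatively open subsets of S) expresses both that
   phi(U) is relatively open and that the inverse of phi is continuous. *)
Definition local_param S U phi : Prop :=
  [/\ open U,
      smooth U phi,
      (forall y z, U y -> U z -> phi y = phi z -> y = z),
      (forall y, U y -> row_free (tangent_frame phi y)) &
      (forall V : set 'rV[R]_k, open V -> V `<=` U ->
         exists2 W : set 'rV[R]_d, open W & phi @` V = S `&` W)].

Definition closed_surface S : Prop :=
  compact S /\
  forall p, S p -> exists U phi, local_param S U phi /\ (phi @` U) p.

Definition C2_on S (u : 'rV[R]_d -> R) : Prop :=
  forall U phi, local_param S U phi -> Ck 2 U (u \o phi).

(* (1 / sqrt(det g)) sum_i d_i (sqrt(det g) sum_j g^ij d_j f) *)
Definition coord_laplace_beltrami phi (f : 'rV[R]_k -> R) (y : 'rV[R]_k) : R :=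
  (Num.sqrt (\det (metric phi y)))^-1 *
  \sum_(i < k)
    partial i (fun z => Num.sqrt (\det (metric phi z)) *
                 \sum_(j < k) invmx (metric phi z) i j * partial j f z) y.

(* The Laplace-Beltrami operator of S at a point p is computed in some local
   parametrization around p; as usual the value is the same in all of them. *)
Definition laplace_beltrami S (u : 'rV[R]_d -> R) (p : 'rV[R]_d) : R :=
  let c := get [set c : ('rV[R]_k -> 'rV[R]_d) * 'rV[R]_k |
                exists U, [/\ local_param S U c.1, U c.2 & c.1 c.2 = p]] in
  coord_laplace_beltrami c.1 (u \o c.1) c.2.

Definition surface_solution S (u : 'rV[R]_d -> R) (lambda : R) : Prop :=
  C2_on S u /\ (forall x, S x -> - laplace_beltrami S u x = lambda * u x).

Definition surface_eigenfunction S (u : 'rV[R]_d -> R) (lambda : R) : Prop :=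
  surface_solution S u lambda /\ (exists2 x, S x & u x != 0).

End Surface.

Arguments closed_surface {R d} k S.
Arguments laplace_beltrami {R d} k S u p.
Arguments surface_solution {R d} k S u lambda.
Arguments surface_eigenfunction {R d} k S u lambda.

Section Embedding.
Variables (R : realType) (d : nat).
Implicit Types (S Omega : set 'rV[R]_d) (cp : 'rV[R]_d -> 'rV[R]_d).

(* On Omega, cp x is the unique point of S closest to x. *)
Definition closest_point_on S Omega cp : Prop :=
  forall x, Omega x ->
    S (cp x) /\
    forall y, S y -> y != cp x -> enorm (x - cp x) < enorm (x - y).

Definition sharp_laplacian cp (eps : R) (v : 'rV[R]_d -> R) (x : 'rV[R]_d) : R :=
  laplacian (v \o cp) x - 2 * d%:R / eps ^+ 2 * (v x - v (cp x)).

(* No regularity is imposed on v itself, only on v o cp, the function which is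
   differentiated. *)
Definition embedded_eigenfunction Omega cp (eps : R)
    (v : 'rV[R]_d -> R) (lambda : R) : Prop :=
  [/\ Ck 2 Omega (v \o cp),
      (forall x, Omega x -> - sharp_laplacian cp eps v x = lambda * v x) &
      (exists2 x, Omega x & v x != 0)].

End Embedding.

(* Main.v *)
Require Import Defs.
From HB Require Import structures.
From mathcomp Require Import all_boot all_order all_algebra.
From mathcomp Require Import all_classical all_reals all_analysis.
From mathcomp Require Import perm ring lra.

(** Everything rests on two facts about the extension [u \o cp] of a function by
    closest points: it is C^2 on [Omega] as soon as [u] is C^2 on [S]
    ([C2_comp_closest_point]), and its Laplacian at a point of [S] is the
    Laplace-Beltrami operator of [u] ([laplacian_closest_point]).  Granted
    these, write [c] for [2d / eps^2].  The embedded equation at [x] reads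
    [(c - lambda) v x = laplacian (v \o cp) x + c v (cp x)], and its right-hand
    side depends only on the values of [v] on [S].  Hence, for [lambda < c], a
    solution is determined by its restriction to [S], through the stated
    formula; at a point of [S], where [cp x = x], the terms in [c] cancel and
    the surface equation remains; and a solution that vanishes on [S] is zero
    when [lambda != c].

    The regularity of [cp] has to be extracted from the mere uniqueness of the
    closest point on an open set.  Continuity follows from the compactness of
    [S].  In a parametrization [phi], write [cp x = phi (Y x)]; then [Y x]
    minimizes [|x - phi y|^2], so it solves the normal equations
    [<x - phi y, d_i phi y> = 0], and the implicit function theorem applies if
    the Hessian of [|x - phi y|^2 / 2] at [Y x] is invertible.  This Hessian is
    the metric for [x] on the surface, it is affine along the ray from [cp x]
    through [x], and it is nonnegative at every point of the ray of which
    [cp x] is still a closest point.  As [Omega] is open there is such a point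
    strictly beyond [x] ([closest_point_beyond]), so the Hessian is positive
    definite at [x] itself ([dist_hessian_pos]): an open set of uniqueness
    contains no focal point.  The point beyond [x] is obtained by maximizing
    the distance to [S] on a small sphere about [x]; the maximum is at least
    [dist x + r], because the distance can be increased at a rate arbitrarily
    close to one as long as the closest point moves continuously.  Since [Y] is
    already known to be continuous, the implicit function theorem needs no
    fixed point argument ([is_derive_implicit]), and the formula that it gives
    for the derivative of [Y] bootstraps to every order ([Ck_chart_coord]).

    For the Laplacian, put [f = u \o phi], let [T_i] be the tangent vectors
    [d_i phi], [g] the metric and [H x] the Hessian above.  The derivative of
    [Y] being [H^-1 T], the gradient of [u \o cp] is the sum over [i] of
    [Z_i(x) T_i(Y x)], with [Z = H^-1 grad f].  On the surface [H = g], so that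
    [Z_i] becomes the contravariant gradient [X^i = g^ij d_j f]; taking the
    divergence there yields the sum over [i] of
    [d_i X^i + X^i g^lm <d_l T_i, T_m>].  As [d_l T_i = d_i T_l], Jacobi's
    formula identifies [g^lm <d_l T_i, T_m>] with the partial derivative of
    [log (sqrt (det g))], and this is the Laplace-Beltrami operator in
    divergence form ([laplacian_comp_cp]). *)

Set Implicit Arguments.
Unset Strict Implicit.
Unset Printing Implicit Defensive.

Import Order.TTheory GRing.Theory Num.Theory.
Import numFieldNormedType.Exports.

Local Open Scope classical_set_scope.
Local Open Scope ring_scope.

(** * Differentiability from continuous partial derivatives *)

Section RowVectors.
Variables (R : realType) (n : nat).
Implicit Types (x : 'rV[R]_n).

Lemma norm_coord_le x i : `|x 0 i| <= `|x|.
Proof.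
rewrite [leRHS]/Num.Def.normr /= mx_normrE.
exact: (le_bigmax _ (fun ij => `|x ij.1 ij.2|) (0, i)).
Qed.

Lemma norm_rV_le x r : 0 <= r -> (forall i, `|x 0 i| <= r) -> `|x| <= r.
Proof.
move=> r0 xr; rewrite [leLHS]/Num.Def.normr /= mx_normrE.
by apply: bigmax_le => // -[i j] _ /=; rewrite (ord1 i).
Qed.

Lemma row_sum_coord x : x = \sum_i x 0 i *: delta_mx 0 i.
Proof. exact: row_sum_delta. Qed.

Lemma continuous_rV (T : topologicalType) (G : T -> 'rV[R]_n) (x : T) :
  (forall j, {for x, continuous (fun z => G z 0 j)}) -> {for x, continuous G}.
Proof.
move=> cG; apply/cvgrPdist_le => e e0; near=> z.
apply: norm_rV_le (ltW e0) _ => i; rewrite !mxE.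
move: i; near: z; apply: filter_forall => i.
by move: (cG i) => /cvgrPdist_le; apply.
Unshelve. all: by end_near. Qed.

End RowVectors.

Section Line.
Variable R : realType.

Lemma is_derive_line (V W : normedModType R) (f : V -> W) (z v : V) (t : R) :
  derivable f (t *: v + z) v ->
  is_derive t 1 (fun s : R => f (s *: v + z)) ('D_v f (t *: v + z)).
Proof.
rewrite /derivable /derive => df.
suff E : (fun h : R => h^-1 *: (((fun s : R => f (s *: v + z)) \o shift t) (h *: 1)
     - f (t *: v + z))) =
   (fun h => h^-1 *: ((f \o shift (t *: v + z)) (h *: v) - f (t *: v + z))).
  by split; rewrite /derivable /derive E.
apply/funext => h /=.
by rewrite (_ : h *: (1 : R) = h) ?scalerDl ?addrA //; exact: mulr1.
Qed.

Lemma MVT_line (V : normedModType R) (f : V -> R) (z v : V) (h : R) :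
  (forall s : R, `|s| <= `|h| -> derivable f (s *: v + z) v) ->
  exists2 s : R, `|s| <= `|h| & f (h *: v + z) - f z = h * 'D_v f (s *: v + z).
Proof.
move=> df; pose g (s : R) := f (s *: v + z).
have dg (s : R) : `|s| <= `|h| -> is_derive s (1 : R) g ('D_v f (s *: v + z)).
  by move=> sh; apply: is_derive_line; apply: df.
have cg (s : R) : `|s| <= `|h| -> {for s, continuous g}.
  move=> sh; apply: differentiable_continuous; apply/derivable1_diffP.
  exact: (@ex_derive _ _ _ _ _ _ _ (dg s sh)).
have g0 : g 0 = f z by rewrite /g scale0r add0r.
have [h0|h0] := leP 0 h.
- have [||s] := @MVT_segment _ g (fun s => 'D_v f (s *: v + z)) 0 h h0.
  + move=> s; rewrite in_itv /= => /andP[s0 sh]; apply: dg.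
    by rewrite !ger0_norm // ltW.
  + apply: continuous_in_subspaceT => s; rewrite inE /= in_itv /= => /andP[s0 sh].
    by apply: cg; rewrite !ger0_norm.
  + rewrite in_itv /= => /andP[s0 sh]; rewrite g0 subr0 mulrC => E.
    by exists s => //; rewrite !ger0_norm.
- have [||s] := @MVT_segment _ g (fun s => 'D_v f (s *: v + z)) h 0 (ltW h0).
  + move=> s; rewrite in_itv /= => /andP[s0 sh]; apply: dg.
    by rewrite !ltr0_norm // lerN2 ltW.
  + apply: continuous_in_subspaceT => s; rewrite inE /= in_itv /= => /andP[s0 sh].
    by apply: cg; rewrite (ltr0_norm h0) ler0_norm // lerN2.
  + rewrite in_itv /= => /andP[s0 sh]; rewrite g0 sub0r => E.
    exists s; first by rewrite (ltr0_norm h0) ler0_norm // lerN2.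
    by rewrite -opprB E mulrN opprK mulrC.
Qed.

(** The increment of [f] is split along the broken line whose m-th edge changes
    the m-th coordinate; the mean value theorem on each edge compares it with
    the partial derivative at [x]. *)
Lemma C1_differentiable n (f : 'rV[R]_n -> R) (x : 'rV[R]_n) :
  (\forall z \near x, forall i, derivable f z (delta_mx 0 i)) ->
  (forall i, {for x, continuous (partial i f)}) -> differentiable f x.
Proof.
move=> df cdf; pose L (h : 'rV[R]_n) : R := \sum_i h 0 i * partial i f x.
have linL : linear L.
  move=> a u v; rewrite /L /= scaler_sumr -big_split; apply: eq_bigr => i _ /=.
  by rewrite !mxE mulrDl -scalerAl.
pose LL : {linear 'rV[R]_n -> R} :=
  HB.pack L (GRing.isLinear.Build _ _ _ _ _ linL).
have cL : continuous L.
  apply: continuous_big => [|i _ h]; first exact: add_continuous.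
  apply: (@continuousM R 'rV[R]_n (fun h => h 0 i) (fun=> partial i f x)).
    exact: coord_continuous.
  exact: cst_continuous.
have FL : f \o shift x = cst (f x) + L +o_ (0 : 'rV[R]_n) id.
  apply/eqaddoP => e e0.
  have e'0 : 0 < e / n.+1%:R by rewrite divr_gt0.
  have : \forall z \near x, (forall i, derivable f z (delta_mx 0 i)) /\
      (forall i, `|partial i f x - partial i f z| <= e / n.+1%:R).
    near=> z; split; first by near: z.
    move=> i; move: i; near: z; apply: filter_forall => i.
    by move: (cdf i) => /cvgrPdist_le; apply.
  move=> /nbhs_ballP[r /= r0 rP].
  near=> h.
  have hr : `|h| < r.
    by near: h; apply/nbhs_ballP; exists r => // z; rewrite -ball_normE /= sub0r normrN.
  pose P (m : nat) : 'rV[R]_n :=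
    \row_(j < n) (if (j < m)%N then h 0 j else 0) + x.
  have PS (m : 'I_n) : P m.+1 = h 0 m *: delta_mx 0 m + P m.
    rewrite /P addrA; congr (_ + _); apply/rowP => j; rewrite !mxE eqxx /= ltnS.
    case: (ltngtP j m) => [jm|jm|/val_inj->]; rewrite ?eqxx ?mulr1 ?addr0 //.
    + by rewrite (_ : (j == m) = false) ?mulr0 ?add0r // -val_eqE ltn_eqF.
    + by rewrite (_ : (j == m) = false) ?mulr0 ?add0r // -val_eqE gtn_eqF.
  have P0 : P 0%N = x by rewrite /P -[RHS]add0r; congr (_ + _); apply/rowP => j; rewrite !mxE.
  have Pn : P n = h + x by rewrite /P; congr (_ + _); apply/rowP => j; rewrite !mxE ltn_ord.
  have Pball (m : 'I_n) s : `|s| <= `|h 0 m| -> ball x r (s *: delta_mx 0 m + P m).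
    move=> sh; rewrite -ball_normE /ball_ /= distrC /P addrA addrK.
    apply: le_lt_trans hr; apply: norm_rV_le => // j; rewrite !mxE eqxx /=.
    case: (eqVneq j m) => [->|jm]; first by rewrite ltnn mulr1 addr0 (le_trans sh) ?norm_coord_le.
    rewrite mulr0 add0r; case: ifP => _; first exact: norm_coord_le.
    by rewrite normr0.
  have step (m : 'I_n) : `|f (P m.+1) - f (P m) - h 0 m * partial m f x| <= e / n.+1%:R * `|h|.
    rewrite PS; have [|s sh ->] := @MVT_line _ f (P m) (delta_mx 0 m) (h 0 m).
      by move=> s sh; have [H _] := rP _ (Pball m s sh); apply: H.
    rewrite -mulrBr normrM mulrC distrC; apply: ler_pM => //; last exact: norm_coord_le.
    by have [_ H] := rP _ (Pball m s sh); apply: H.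
  have -> : (f \o shift x - (cst (f x) + L)) h =
      \sum_(m < n) (f (P m.+1) - f (P m) - h 0 m * partial m f x).
    rewrite sumrB -(big_mkord xpredT (fun m => f (P m.+1) - f (P m))) telescope_sumr //.
    by rewrite Pn P0 -![(_ - _ : _ -> _) _]/(_ - _) -![(_ + _ : _ -> _) _]/(_ + _) /= opprD addrA.
  apply: le_trans (ler_norm_sum _ _ _) _.
  apply: (@le_trans _ _ (\sum_(m < n) (e / n.+1%:R * `|h|))); first exact: ler_sum.
  rewrite sumr_const card_ord -[leLHS]mulr_natl mulrA ler_wpM2r // mulrCA ger_pMr //.
  by rewrite ler_pdivrMr // mul1r ler_nat.
have dE : 'd f x = L :> (_ -> _) by apply: (@diff_unique _ _ _ f LL x cL FL).
by apply/diff_locallyP; rewrite dE.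
Unshelve. all: by end_near. Qed.

Lemma derive_partial n (f : 'rV[R]_n -> R) (x v : 'rV[R]_n) :
  differentiable f x -> 'D_v f x = \sum_i v 0 i * partial i f x.
Proof.
move=> df; rewrite deriveE // {1}(row_sum_coord v) linear_sum.
by apply: eq_bigr => i _; rewrite linearZ_LR /partial deriveE.
Qed.

Lemma is_derive_comp (V W X : normedModType R) (f : W -> X) (G : V -> W) (x v : V) :
  differentiable f (G x) -> derivable G x v ->
  is_derive x v (f \o G) ('D_('D_v G x) f (G x)).
Proof.
move=> df dG.
have dg : derivable (fun h : R => G (h *: v + x)) 0 1.
  by have /derivable1P := dG.
have dgv : 'D_1 (fun h : R => G (h *: v + x)) 0 = 'D_v G x.
  have [|_] := @is_derive_line _ _ G x v 0; first by rewrite scale0r add0r.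
  by rewrite scale0r add0r.
have df' : differentiable f (G (0 *: v + x)) by rewrite scale0r add0r.
have dfg : differentiable (f \o (fun h : R => G (h *: v + x))) 0.
  by apply: differentiable_comp => //; apply/derivable1_diffP.
have dc : derivable (f \o G) x v by apply/derivable1P/derivable1_diffP.
split => //; have [|_] := @is_derive_line _ _ (f \o G) x v 0.
  by rewrite scale0r add0r.
rewrite scale0r add0r => <-.
have dGd : differentiable (fun h : R => G (h *: v + x)) 0 by apply/derivable1_diffP.
transitivity ('d (f \o (fun h : R => G (h *: v + x))) 0 (1 : R)); first exact: deriveE.
rewrite diff_comp //= -(deriveE _ df').
by rewrite -(deriveE (1 : R) dGd) dgv scale0r add0r.
Qed.

End Line.

Lemma is_derive_sum_fun (R : realType) (V : normedModType R) (n : nat)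
    (F : 'I_n -> V -> R) (dF : 'I_n -> R) (x v : V) :
  (forall i, is_derive x v (F i) (dF i)) ->
  is_derive x v (fun z => \sum_i F i z) (\sum_i dF i).
Proof.
move=> DF; have -> : (fun z => \sum_i F i z) = \sum_i F i.
  by apply/funext => z; rewrite fct_sumE.
exact: is_derive_sum.
Qed.

(** * Calculus of functions with continuous partial derivatives *)

Section CkGeneral.
Variables (R : realType) (n : nat) (V : normedModType R).
Implicit Types (U W : set 'rV[R]_n) (f g : 'rV[R]_n -> V).

Lemma Ck_continuous m U f x : Ck m U f -> U x -> {for x, continuous f}.
Proof. by case: m => [|m] [cf _] Ux; exact: cf. Qed.

Lemma Ck_derivable m U f i x : Ck m.+1 U f -> U x -> derivable f x (delta_mx 0 i).
Proof. by case=> _ /(_ i)[df _] Ux; exact: df. Qed.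

Lemma Ck_partial m U f i : Ck m.+1 U f -> Ck m U (partial i f).
Proof. by case=> _ /(_ i)[]. Qed.

Lemma CkW m U f : Ck m.+1 U f -> Ck m U f.
Proof.
elim: m f => [|m IH] f [cf df]; first by [].
by split=> // i; have [dfi Cf] := df i; split=> //; exact: IH.
Qed.

Lemma Ck_local m U f :
  (forall x, U x -> exists2 W, W x & Ck m W f) -> Ck m U f.
Proof.
elim: m f => [|m IH] f H; split=> //.
- by move=> x /H[W Wx /Ck_continuous]; apply.
- by move=> x /H[W Wx /Ck_continuous]; apply.
- move=> i; split; first by move=> x /H[W Wx /Ck_derivable]; apply.
  by apply: IH => x /H[W Wx /Ck_partial C]; exists W.
Qed.

Lemma eq_partial U f g i x : open U -> (forall z, U z -> f z = g z) -> U x ->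
  partial i f x = partial i g x.
Proof.
move=> oU fg Ux; apply: near_eq_derive; near=> z; apply: fg; near: z.
exact: open_nbhs_nbhs.
Unshelve. all: by end_near. Qed.

Lemma eq_continuous_at U f g x : open U -> (forall z, U z -> f z = g z) -> U x ->
  {for x, continuous f} -> {for x, continuous g}.
Proof.
move=> oU fg Ux cf; rewrite /prop_for /continuous_at -fg //.
apply: cvg_trans cf; apply: (@near_eq_cvg _ _ (nbhs x)); near=> z; apply: fg; near: z.
exact: open_nbhs_nbhs.
Unshelve. all: by end_near. Qed.

Lemma eq_Ck m U f g : open U -> (forall z, U z -> f z = g z) ->
  Ck m U f -> Ck m U g.
Proof.
move=> oU; elim: m f g => [|m IH] f g fg [cf df]; split => //.
- by move=> x Ux; exact: (eq_continuous_at oU fg Ux (cf x Ux)).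
- by move=> x Ux; exact: (eq_continuous_at oU fg Ux (cf x Ux)).
- move=> i; have [dfi Cf] := df i; split.
    move=> x Ux; apply: near_eq_derivable (dfi x Ux).
    by near=> z; apply: fg; near: z; exact: open_nbhs_nbhs.
  by apply: IH Cf => z Uz; exact: (eq_partial i oU fg).
Unshelve. all: by end_near. Qed.

Lemma Ck_is_derive m U f x i : Ck m.+1 U f -> U x ->
  is_derive x (delta_mx 0 i) f (partial i f x).
Proof. by move=> C Ux; split=> //; exact: Ck_derivable C Ux. Qed.

End CkGeneral.

Section CkScalar.
Variables (R : realType) (n : nat).
Implicit Types (U W : set 'rV[R]_n) (f g : 'rV[R]_n -> R).

Lemma Ck_differentiable m U f x : open U -> Ck m.+1 U f -> U x ->
  differentiable f x.
Proof.
move=> oU C Ux; apply: C1_differentiable.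
  near=> z => i; apply: Ck_derivable C _; near: z; exact: open_nbhs_nbhs.
by move=> i; exact: Ck_continuous (Ck_partial i C) Ux.
Unshelve. all: by end_near. Qed.

Lemma Ck_cst m U (a : R) : open U -> Ck m U (fun=> a).
Proof.
move=> oU; elim: m a => [|m IH] a; split=> //; try by move=> x Ux; exact: cst_continuous.
move=> i; split; first by move=> x Ux; exact: derivable_cst.
by apply: (eq_Ck oU _ (IH 0)) => x Ux; rewrite /partial derive_cst.
Qed.

Lemma CkD m U f g : open U -> Ck m U f -> Ck m U g -> Ck m U (fun x => f x + g x).
Proof.
move=> oU; elim: m f g => [|m IH] f g Cf Cg.
  by split=> // x Ux; apply: continuousD; [exact: Ck_continuous Cf Ux|exact: Ck_continuous Cg Ux].
split=> [x Ux|i].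
  by apply: continuousD; [exact: Ck_continuous Cf Ux|exact: Ck_continuous Cg Ux].
split=> [x Ux|].
  by apply: derivableD; [exact: Ck_derivable Cf Ux|exact: Ck_derivable Cg Ux].
apply: (eq_Ck oU _ (IH _ _ (Ck_partial i Cf) (Ck_partial i Cg))) => x Ux.
by rewrite /partial deriveD //; [exact: Ck_derivable Cf Ux|exact: Ck_derivable Cg Ux].
Qed.

(** The product rule writes a partial derivative of [f * g] with products of
    functions that are only assumed C^m, hence the induction on the order; the
    lemmas on inverses and compositions follow the same scheme. *)
Lemma CkM m U f g : open U -> Ck m U f -> Ck m U g -> Ck m U (fun x => f x * g x).
Proof.
move=> oU; elim: m f g => [|m IH] f g Cf Cg.
  by split=> // x Ux; apply: continuousM; [exact: Ck_continuous Cf Ux|exact: Ck_continuous Cg Ux].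
split=> [x Ux|i].
  by apply: continuousM; [exact: Ck_continuous Cf Ux|exact: Ck_continuous Cg Ux].
split=> [x Ux|].
  by apply: derivableM; [exact: Ck_derivable Cf Ux|exact: Ck_derivable Cg Ux].
have C := CkD oU (IH _ _ (CkW Cf) (Ck_partial i Cg)) (IH _ _ (CkW Cg) (Ck_partial i Cf)).
apply: (eq_Ck oU _ C) => x Ux.
by rewrite /partial deriveM //; [exact: Ck_derivable Cf Ux|exact: Ck_derivable Cg Ux].
Qed.

Lemma Ck_sum m U (I : Type) (r : seq I) (P : pred I) (F : I -> 'rV[R]_n -> R) :
  open U -> (forall i, P i -> Ck m U (F i)) ->
  Ck m U (fun x => \sum_(i <- r | P i) F i x).
Proof.
move=> oU CF; elim: r => [|i r IH].
  by apply: (eq_Ck oU _ (Ck_cst m 0 oU)) => x _; rewrite big_nil.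
have [Pi|nPi] := boolP (P i).
  by apply: (eq_Ck oU _ (CkD oU (CF i Pi) IH)) => x _; rewrite big_cons Pi.
by apply: (eq_Ck oU _ IH) => x _; rewrite big_cons (negbTE nPi).
Qed.

Lemma Ck_prod m U (I : Type) (r : seq I) (P : pred I) (F : I -> 'rV[R]_n -> R) :
  open U -> (forall i, P i -> Ck m U (F i)) ->
  Ck m U (fun x => \prod_(i <- r | P i) F i x).
Proof.
move=> oU CF; elim: r => [|i r IH].
  by apply: (eq_Ck oU _ (Ck_cst m 1 oU)) => x _; rewrite big_nil.
have [Pi|nPi] := boolP (P i).
  by apply: (eq_Ck oU _ (CkM oU (CF i Pi) IH)) => x _; rewrite big_cons Pi.
by apply: (eq_Ck oU _ IH) => x _; rewrite big_cons (negbTE nPi).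
Qed.

Lemma CkZ m U (a : R) f : open U -> Ck m U f -> Ck m U (fun x => a * f x).
Proof. by move=> oU; apply: CkM => //; exact: Ck_cst. Qed.

Lemma CkB m U f g : open U -> Ck m U f -> Ck m U g -> Ck m U (fun x => f x - g x).
Proof.
move=> oU Cf Cg; apply: (eq_Ck oU _ (CkD oU Cf (CkZ (-1) oU Cg))) => x _.
by rewrite mulN1r.
Qed.

Lemma CkV m U f : open U -> (forall x, U x -> f x != 0) -> Ck m U f ->
  Ck m U (fun x => (f x)^-1).
Proof.
move=> oU f0; elim: m => [|m IH] Cf.
  by split=> // x Ux; apply: continuousV; [exact: f0|exact: Ck_continuous Cf Ux].
split=> [x Ux|i].
  by apply: continuousV; [exact: f0|exact: Ck_continuous Cf Ux].
split=> [x Ux|].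
  by apply: derivableV; [exact: f0|exact: Ck_derivable Cf Ux].
have CV := IH (CkW Cf).
have C := CkZ (-1) oU (CkM oU (CkM oU CV CV) (Ck_partial i Cf)).
apply: (eq_Ck oU _ C) => x Ux.
rewrite /partial deriveV //; [|exact: f0|exact: Ck_derivable Cf Ux].
by rewrite mulN1r -exprVn expr2 scaleNr.
Qed.

Lemma Ck_id_coord m U j : open U -> Ck m U (fun x => x 0 j).
Proof.
move=> oU; case: m => [|m]; split=> //; try by move=> x Ux; exact: coord_continuous.
move=> i; have dc (x : 'rV[R]_n) : is_derive x (delta_mx 0 i)
    (fun z : 'rV[R]_n => z 0 j) ((i == j)%:R : R).
  have d : differentiable (fun z : 'rV[R]_n => z 0 j) x by exact: differentiable_coord.
  split; first exact: diff_derivable.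
  have E := derive_mx (@derivable_id R _ x (delta_mx 0 i)).
  have := congr1 (fun M : 'rV[R]_n => M 0 j) E; rewrite mxE => <-.
  by rewrite derive_id mxE eqxx /= eq_sym.
split=> [x Ux|]; first by case: (dc x).
by apply: (eq_Ck oU _ (Ck_cst m (i == j)%:R oU)) => x Ux; case: (dc x).
Qed.

Lemma Ck_det m U p (A : 'rV[R]_n -> 'M[R]_p) : open U ->
  (forall i j, Ck m U (fun x => A x i j)) -> Ck m U (fun x => \det (A x)).
Proof.
by move=> oU CA; apply: Ck_sum => // s _; apply: CkZ => //; apply: Ck_prod.
Qed.

Lemma Ck_invmx m U p (A : 'rV[R]_n -> 'M[R]_p) i j : open U ->
  (forall x, U x -> A x \in unitmx) ->
  (forall i j, Ck m U (fun x => A x i j)) -> Ck m U (fun x => invmx (A x) i j).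
Proof.
move=> oU uA CA.
have CV : Ck m U (fun x => (\det (A x))^-1).
  by apply: CkV => // [x Ux|]; [rewrite -unitfE -unitmxE uA|exact: Ck_det].
have Ccof : Ck m U (fun x => cofactor (A x) j i).
  apply: CkZ => //; apply: Ck_det => // a b.
  apply: eq_Ck (CA (lift j a) (lift i b)) => // x _; by rewrite !mxE.
apply: (eq_Ck oU _ (CkM oU CV Ccof)) => x Ux.
by rewrite /invmx uA // !mxE.
Qed.

End CkScalar.

Section CkVector.
Variables (R : realType) (n p : nat).
Implicit Types (U : set 'rV[R]_n) (G : 'rV[R]_n -> 'rV[R]_p).

Lemma partial_coord G i x j : derivable G x (delta_mx 0 i) ->
  partial i (fun z => G z 0 j) x = partial i G x 0 j.
Proof. by move=> dG; rewrite /partial (derive_mx dG) mxE. Qed.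

Lemma Ck_coord m U G j : open U -> Ck m U G -> Ck m U (fun x => G x 0 j).
Proof.
move=> oU; elim: m G => [|m IH] G CG.
  split=> // x Ux; apply: (@continuous_comp _ _ _ G (fun M : 'rV[R]_p => M 0 j)).
    exact: Ck_continuous CG Ux.
  exact: coord_continuous.
split=> [x Ux|i].
  apply: (@continuous_comp _ _ _ G (fun M : 'rV[R]_p => M 0 j)).
    exact: Ck_continuous CG Ux.
  exact: coord_continuous.
split=> [x Ux|].
  by have /derivable_mxP := @Ck_derivable _ _ _ _ _ _ i x CG Ux; apply.
apply: (eq_Ck oU _ (IH _ (Ck_partial i CG))) => x Ux.
by rewrite partial_coord //; exact: Ck_derivable CG Ux.
Qed.

Lemma is_derive_comp_coord (f : 'rV[R]_p -> R) G (x v : 'rV[R]_n) :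
  differentiable f (G x) -> (forall j, derivable (fun z => G z 0 j) x v) ->
  is_derive x v (f \o G) (\sum_j partial j f (G x) * 'D_v (fun z => G z 0 j) x).
Proof.
move=> df dGj.
have dG : derivable G x v by apply/derivable_mxP => i j; rewrite (ord1 i).
apply: is_derive_eq (is_derive_comp df dG) _.
rewrite derive_partial //; apply: eq_bigr => j _.
by rewrite derive_mx // mxE mulrC.
Qed.

Lemma Ck_comp m (U : set 'rV[R]_n) (W : set 'rV[R]_p) (f : 'rV[R]_p -> R) G :
  open U -> open W -> (forall x, U x -> W (G x)) ->
  Ck m W f -> (forall j, Ck m U (fun x => G x 0 j)) -> Ck m U (f \o G).
Proof.
move=> oU oW UW; elim: m f => [|m IH] f Cf CG; have cG x : U x -> {for x, continuous G}.
- by move=> Ux; apply: continuous_rV => j; exact: Ck_continuous (CG j) Ux.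
- split=> // x Ux; apply: continuous_comp; first exact: cG.
  by apply: Ck_continuous Cf _; exact: UW.
- by move=> Ux; apply: continuous_rV => j; exact: Ck_continuous (CG j) Ux.
have df x : U x -> differentiable f (G x).
  by move=> Ux; apply: Ck_differentiable Cf _ => //; exact: UW.
split=> [x Ux|i].
  apply: continuous_comp; first exact: cG.
  by apply: Ck_continuous Cf _; exact: UW.
have D x : U x -> is_derive x (delta_mx 0 i) (f \o G)
    (\sum_j partial j f (G x) * partial i (fun z => G z 0 j) x).
  move=> Ux; apply: is_derive_comp_coord; first exact: df.
  by move=> j; exact: Ck_derivable (CG j) Ux.
split=> [x /D[]//|].
have C : Ck m U (fun x => \sum_j (partial j f \o G) x * partial i (fun z => G z 0 j) x).
  apply: Ck_sum => // j _; apply: CkM => //; last exact: Ck_partial.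
  by apply: IH => [|j']; [exact: Ck_partial|exact: CkW].
by apply: (eq_Ck oU _ C) => x /D[_ <-].
Qed.

Lemma partial_comp m (U : set 'rV[R]_n) (W : set 'rV[R]_p) (f : 'rV[R]_p -> R) G i x :
  open U -> open W -> W (G x) -> U x -> Ck m.+1 W f -> (forall j, Ck m.+1 U (fun x => G x 0 j)) ->
  partial i (f \o G) x = \sum_j partial j f (G x) * partial i (fun z => G z 0 j) x.
Proof.
move=> oU oW WGx Ux Cf CG; apply: derive_val; apply: is_derive_comp_coord.
  exact: Ck_differentiable Cf WGx.
by move=> j; exact: Ck_derivable (CG j) Ux.
Qed.

End CkVector.

(** * Second derivatives *)

Section SecondOrder.
Variable R : realType.

Lemma MVT_line_pos (V : normedModType R) (f : V -> R) (z v : V) (h : R) : 0 < h ->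
  (forall s : R, `|s| <= h -> derivable f (s *: v + z) v) ->
  exists2 s : R, 0 < s < h & f (h *: v + z) - f z = h * 'D_v f (s *: v + z).
Proof.
move=> h0 df; pose g (s : R) := f (s *: v + z).
have dg (s : R) : `|s| <= h -> is_derive s (1 : R) g ('D_v f (s *: v + z)).
  by move=> sh; apply: is_derive_line; apply: df.
have [||s] := @MVT _ g (fun s => 'D_v f (s *: v + z)) 0 h h0.
- by move=> s; rewrite in_itv /= => /andP[s0 sh]; apply: dg; rewrite ger0_norm // ltW.
- apply: continuous_in_subspaceT => s; rewrite inE /= in_itv /= => /andP[s0 sh].
  apply: differentiable_continuous; apply/derivable1_diffP.
  by apply: (@ex_derive _ _ _ _ _ _ _ (dg s _)); rewrite ger0_norm.
- rewrite in_itv /= => sh; rewrite {2}/g scale0r add0r subr0 mulrC => E.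
  by exists s.
Qed.

Lemma diff_estimate (V W : normedModType R) (f : V -> W) (x : V) (e : R) :
  differentiable f x -> 0 < e ->
  exists2 r : R, 0 < r &
    forall h, `|h| < r -> `|f (h + x) - f x - 'd f x h| <= e * `|h|.
Proof.
move=> df e0; have /eqaddoP /(_ e e0) := diff_locally df.
move=> /nbhs_ballP[r /= r0 rP]; exists r => // h hr.
have := rP h; rewrite -ball_normE /ball_ /= sub0r normrN => /(_ hr).
by rewrite -![(_ - _ : _ -> _) _]/(_ - _) -![(_ + _ : _ -> _) _]/(_ + _) /= opprD addrA.
Qed.

Lemma is_derive_shift_arg (V W : normedModType R) (f : V -> W) (a x v : V) :
  derivable f (a + x) v -> is_derive x v (fun z => f (a + z)) ('D_v f (a + x)).
Proof.
rewrite /derivable /derive => df.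
suff E : (fun h : R => h^-1 *: (((fun z => f (a + z)) \o shift x) (h *: v)
     - f (a + x))) =
   (fun h => h^-1 *: ((f \o shift (a + x)) (h *: v) - f (a + x))).
  by split; rewrite /derivable /derive E.
by apply/funext => h /=; rewrite addrCA.
Qed.

Variable n : nat.
Implicit Types (U : set 'rV[R]_n) (f : 'rV[R]_n -> R).
Local Notation e_ i := (delta_mx 0 i : 'rV[R]_n).

Lemma norm_delta (i : 'I_n) : `|e_ i| = 1.
Proof.
apply/eqP; rewrite eq_le; apply/andP; split.
  apply: norm_rV_le => // j; rewrite mxE eqxx /=.
  by case: (j == i); rewrite ?normr1 ?normr0.
by have := norm_coord_le (e_ i) i; rewrite mxE !eqxx normr1.
Qed.

(** The mixed second difference is evaluated by the mean value theorem in
    direction [e_ i] and then by the differentiability of [partial i f]; its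
    symmetry in the two directions is what makes partial derivatives commute. *)
Lemma second_difference U f x i j (e : R) :
  open U -> Ck 2 U f -> U x -> 0 < e ->
  exists2 r : R, 0 < r & forall s, 0 < s < r ->
   `|f (s *: e_ j + (s *: e_ i + x)) - f (s *: e_ i + x) -
     (f (s *: e_ j + x) - f x) - s ^+ 2 * partial j (partial i f) x| <= e * s ^+ 2.
Proof.
move=> oU Cf Ux e0.
have Cg := Ck_partial i Cf.
have dg := Ck_differentiable oU Cg Ux.
(* The increments at which [partial i f] is linearized have norms at most
   [2 s] and [s], which accounts for the factor three. *)
have e30 : 0 < e / 3 by rewrite divr_gt0.
have [r1 r10 Hr1] := diff_estimate dg e30.
have /nbhs_ballP[r2 /= r20 Hr2] := open_nbhs_nbhs (conj oU Ux).
have inU h : `|h| < r2 -> U (h + x).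
  by move=> hr; apply: Hr2; rewrite -ball_normE /ball_ /= distrC addrK.
exists (Num.min r1 r2 / 2); first by rewrite divr_gt0 // lt_min r10.
move=> s /andP[s0]; rewrite ltr_pdivlMr // lt_min => /andP[s1 s2].
have n2 (t : R) : `|t| <= s -> `|s *: e_ j + t *: e_ i| <= s * 2.
  move=> ts; apply: le_trans (ler_normD _ _) _; rewrite !normrZ !norm_delta !mulr1.
  by rewrite (gtr0_norm s0) mulr_natr mulr2n lerD2l.
have n1 (t : R) : `|t| <= s -> `|t *: e_ i| <= s by rewrite normrZ norm_delta mulr1.
have sls : s < s * 2 by rewrite mulr_natr mulr2n ltrDl.
pose F z := f (s *: e_ j + z) - f z.
have dF (t : R) : `|t| <= s -> is_derive (t *: e_ i + x) (e_ i) F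
   (partial i f (s *: e_ j + (t *: e_ i + x)) - partial i f (t *: e_ i + x)).
  move=> ts; apply: is_deriveB.
    apply: is_derive_shift_arg; apply: Ck_derivable Cf _; rewrite addrA; apply: inU.
    exact: le_lt_trans (n2 _ ts) s2.
  apply: (Ck_is_derive i Cf); apply: inU; apply: le_lt_trans (n1 _ ts) _.
  exact: lt_trans s2.
have [|t ts] := @MVT_line _ _ F x (e_ i) s.
  by move=> t; rewrite (gtr0_norm s0) => ts; case: (dF t ts).
rewrite (gtr0_norm s0) in ts.
have [_ ->] := dF t ts; rewrite /F => ->.
have n1t := n1 _ ts; have n2t := n2 _ ts.
have E1 := Hr1 _ (le_lt_trans n1t (lt_trans sls s1)).
have E2 := Hr1 _ (le_lt_trans n2t s1).
have {}E1 : `|partial i f (t *: e_ i + x) - partial i f x -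
    'd (partial i f) x (t *: e_ i)| <= e / 3 * s.
  by apply: le_trans E1 _; rewrite ler_pM2l.
have {}E2 := le_trans E2 (ler_wpM2l (ltW e30) n2t).
move: E2; rewrite [X in `|X|](_ : _ = partial i f (s *: e_ j + (t *: e_ i + x)) -
   partial i f x - 'd (partial i f) x (t *: e_ i) - s * partial j (partial i f) x); last first.
  have -> : 'd (partial i f) x (s *: e_ j + t *: e_ i) =
      s * partial j (partial i f) x + 'd (partial i f) x (t *: e_ i).
    by rewrite linearD linearZ_LR [partial j _ _]deriveE.
  by rewrite addrA; ring.
rewrite expr2 -mulrA -mulrBr normrM (gtr0_norm s0) (_ : e * (s * s) = s * (e * s)); last by ring.
rewrite ler_pM2l //.
move: E1.
set A := partial i f _; set B := partial i f x; set C := 'd _ _ _.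
set D := partial i f _; set G := partial j _ _.
rewrite !ler_norml => /andP[? ?] /andP[? ?]; apply/andP; split; lra.
Qed.

Lemma partialC U f x i j : open U -> Ck 2 U f -> U x ->
  partial i (partial j f) x = partial j (partial i f) x.
Proof.
move=> oU Cf Ux.
have aux (f1 f2 f3 f4 p a b e : R) : `|f1 - f2 - (f3 - f4) - p * a| <= e / 2 * p ->
    `|f1 - f3 - (f2 - f4) - p * b| <= e / 2 * p -> `|p * (a - b)| <= p * e.
  by rewrite !ler_norml => /andP[? ?] /andP[? ?]; apply/andP; split; lra.
apply/eqP; rewrite -subr_eq0 -normr_le0; apply/ler_addgt0Pl => e e0.
have e20 : 0 < e / 2 by rewrite divr_gt0.
have [r1 r10 H1] := second_difference i j oU Cf Ux e20.
have [r2 r20 H2] := second_difference j i oU Cf Ux e20.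
pose s := Num.min r1 r2 / 2.
have m0 : 0 < Num.min r1 r2 by rewrite lt_min r10.
have s0 : 0 < s by rewrite divr_gt0.
have sm : s < Num.min r1 r2 by rewrite ltr_pdivrMr // mulr_natr mulr2n ltrDl.
move: sm; rewrite lt_min => /andP[s1 s2].
have {}H1 := H1 s; have {}H2 := H2 s.
rewrite s0 s1 in H1; rewrite s0 s2 in H2.
have {}H1 := H1 isT; have {}H2 := H2 isT.
move: H2; rewrite (addrCA (s *: e_ i)) => H2.
rewrite addr0 -(ler_pM2l (exprn_gt0 2 s0)) -[X in X * _](gtr0_norm (exprn_gt0 2 s0)) -normrM.
exact: aux H2 H1.
Qed.

(** A small step against the [i]-th partial derivative would decrease [f]. *)
Lemma partial_at_min U f x i : open U -> Ck 1 U f -> U x ->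
  (forall z, U z -> f x <= f z) -> partial i f x = 0.
Proof.
move=> oU Cf Ux fmin; apply/eqP/negPn/negP => c0.
have df := Ck_differentiable oU Cf Ux.
set c := partial i f x in c0.
have e0 : 0 < `|c| / 2 by rewrite divr_gt0 // normr_gt0.
have [r1 r10 Hr1] := diff_estimate df e0.
have /nbhs_ballP[r2 /= r20 Hr2] := open_nbhs_nbhs (conj oU Ux).
have m0 : 0 < Num.min r1 r2 by rewrite lt_min r10.
pose t := Num.min r1 r2 / 2 / `|c|.
have t0 : 0 < t by rewrite !divr_gt0 // normr_gt0.
pose h := (- (t * c)) *: e_ i.
have nh : `|h| = t * `|c|.
  by rewrite normrZ norm_delta mulr1 normrN normrM (gtr0_norm t0).
have : `|h| < Num.min r1 r2.
  by rewrite nh /t divfK ?normr_eq0 // ltr_pdivrMr // mulr_natr mulr2n ltrDl.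
rewrite lt_min => /andP[h1 h2].
have Uh : U (h + x) by apply: Hr2; rewrite -ball_normE /ball_ /= distrC addrK.
have := Hr1 h h1; rewrite nh.
have -> : 'd f x h = - (t * c ^+ 2).
  rewrite linearZ -(deriveE (e_ i) df) -/(partial i f x) -/c.
  by rewrite [LHS]mulNr expr2 mulrA.
rewrite ler_norml => /andP[_]; have := fmin _ Uh.
have -> : `|c| / 2 * (t * `|c|) = t * c ^+ 2 / 2.
  by rewrite -(real_normK (num_real c)) expr2; ring.
have : 0 < t * c ^+ 2 by rewrite mulr_gt0 // exprn_even_gt0.
lra.
Qed.

(** Were the quadratic form negative at [xi], the derivative of [f] along [xi],
    which vanishes at [x], would be negative on a short segment that leaves [x]
    in this direction, and [f] would decrease along it. *)
Lemma hessian_at_min U f x (xi : 'rV[R]_n) : open U -> Ck 2 U f -> U x ->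
  (forall z, U z -> f x <= f z) ->
  0 <= \sum_i \sum_j xi 0 i * xi 0 j * partial j (partial i f) x.
Proof.
move=> oU Cf Ux fmin; rewrite leNgt; apply/negP; set Q := (X in X < 0) => Q0.
pose g z := \sum_i xi 0 i * partial i f z.
have Cg : Ck 1 U g.
  by apply: Ck_sum => // i _; apply: CkZ => //; exact: Ck_partial.
have dg := Ck_differentiable oU Cg Ux.
have gx : g x = 0.
  by apply: big1 => i _; rewrite (partial_at_min _ oU (CkW Cf)) ?mulr0.
have dgxi : 'd g x xi = Q.
  rewrite -deriveE // derive_partial // /Q exchange_big /=; apply: eq_bigr => j _.
  have D : is_derive x (e_ j) g (\sum_i xi 0 i * partial j (partial i f) x).
    apply: is_derive_sum_fun => i.
    exact: (is_deriveZ (xi 0 i) (Ck_is_derive j (Ck_partial i Cf) Ux)).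
  have [_ E] := D; rewrite /partial E mulr_sumr; apply: eq_bigr => i _.
  by rewrite mulrA (mulrC (xi 0 j)).
have e0 : 0 < - Q / 2 / (`|xi| + 1).
  by rewrite !divr_gt0 ?oppr_gt0 // ltr_wpDl.
have [r1 r10 Hr1] := diff_estimate dg e0.
have /nbhs_ballP[r2 /= r20 Hr2] := open_nbhs_nbhs (conj oU Ux).
have m0 : 0 < Num.min r1 r2 by rewrite lt_min r10.
have xi1 : 0 < `|xi| + 1 by rewrite ltr_wpDl.
pose s := Num.min r1 r2 / (`|xi| + 1).
have s0 : 0 < s by rewrite divr_gt0.
have small (t : R) : `|t| <= s / 2 -> `|t *: xi| < Num.min r1 r2.
  move=> ts; rewrite normrZ; apply: (@le_lt_trans _ _ (s / 2 * (`|xi| + 1))).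
    by apply: ler_pM => //; rewrite lerDl.
  by rewrite mulrAC /s divfK ?gt_eqF // ltr_pdivrMr // mulr_natr mulr2n ltrDl.
have inU (t : R) : `|t| <= s / 2 -> U (t *: xi + x).
  move=> /small; rewrite lt_min => /andP[_ h]; apply: Hr2.
  by rewrite -ball_normE /ball_ /= distrC addrK.
have df (t : R) : `|t| <= s / 2 -> differentiable f (t *: xi + x).
  by move=> /inU Ut; exact: Ck_differentiable oU Cf Ut.
have s20 : 0 < s / 2 by rewrite divr_gt0.
have [|t /andP[t0 ts]] := @MVT_line_pos _ f x xi _ s20.
  by move=> t ts; apply: diff_derivable; exact: df.
have nt : `|t| <= s / 2 by rewrite gtr0_norm // ltW.
rewrite derive_partial; last exact: df.
rewrite -/(g (t *: xi + x)) => E.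
have := fmin _ (inU (s / 2) _); rewrite (gtr0_norm s20) lexx => /(_ isT).
rewrite -subr_ge0 E pmulr_rge0 //; apply/negP; rewrite -ltNge.
have := small t nt; rewrite lt_min => /andP[/Hr1 + _].
have -> : 'd g x (t *: xi) = t * Q by rewrite linearZ_LR dgxi.
rewrite gx subr0 normrZ (gtr0_norm t0) ler_norml => /andP[_].

have : - Q / 2 / (`|xi| + 1) * (t * `|xi|) <= - Q / 2 * t.
  rewrite (_ : _ * (t * `|xi|) = - Q / 2 * t * (`|xi| / (`|xi| + 1))); last by ring.
  rewrite ger_pMr; last by rewrite mulr_gt0 // divr_gt0 // oppr_gt0.
  by rewrite ler_pdivrMr // mul1r lerDl.
have : t * Q < 0 by rewrite pmulr_rlt0.
by rewrite [- Q / 2 * t](_ : _ = - (t * Q) / 2); [lra|ring].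
Qed.

End SecondOrder.

(** * Determinants and Gram matrices *)

Section Determinants.
Variable R : realType.

Lemma is_derive_prod (V : normedModType R) (I : eqType) (r : seq I)
    (F : I -> V -> R) (dF : I -> R) (x v : V) : uniq r ->
  (forall i, is_derive x v (F i) (dF i)) ->
  is_derive x v (fun z => \prod_(i <- r) F i z)
    (\sum_(i <- r) dF i * \prod_(j <- r | j != i) F j x).
Proof.
move=> + DF; elim: r => [_|a r IH /= /andP[ar ur]].
  rewrite big_nil (_ : (fun z => _) = cst 1); first exact: is_derive_cst.
  by apply/funext => z; rewrite big_nil.
rewrite (_ : (fun z => _) = F a * (fun z => \prod_(i <- r) F i z)); last first.
  by apply/funext => z; rewrite big_cons.
apply: is_derive_eq (is_deriveM (DF a) (IH ur)) _.
rewrite big_cons big_cons eqxx addrC /= [X in X + _]mulrC; congr (_ * _ + _).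
  rewrite big_seq_cond [RHS]big_seq_cond; apply: eq_bigl => j.
  by rewrite andbT; case: eqVneq => [->|_]; rewrite ?andbT // andbF (negbTE ar).
rewrite [LHS]mulr_sumr [LHS]big_seq [RHS]big_seq; apply: eq_bigr => i ir.
rewrite big_cons ifT; last by apply: contraNneq ar => ->.
by rewrite mulrCA.
Qed.

(** Differentiating one row at a time, and expanding each of the resulting
    determinants along the row that was differentiated. *)
Lemma is_derive_det (V : normedModType R) p (A : V -> 'M[R]_p) (dA : 'M[R]_p) (x v : V) :
  (forall i j, is_derive x v (fun z => A z i j) (dA i j)) ->
  is_derive x v (fun z => \det (A z)) (\sum_i \sum_j dA i j * cofactor (A x) i j).
Proof.
move=> DA.
have -> : (fun z => \det (A z)) =
    \sum_(s : 'S_p) ((-1) ^+ s *: (fun z => \prod_i A z i (s i)) : V -> R).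
  by apply/funext => z; rewrite fct_sumE.
have D : is_derive x v (\sum_(s : 'S_p) ((-1) ^+ s *: (fun z => \prod_i A z i (s i)) : V -> R))
   (\sum_(s : 'S_p) (-1) ^+ s * (\sum_i dA i (s i) * \prod_(j | j != i) A x j (s j))).
  elim/big_ind2 : _ => [|f df g dg Df Dg|s _]; first exact: is_derive_cst.
  - exact: is_deriveD.
  - apply: is_deriveZ.
    apply: (@is_derive_prod V _ (index_enum 'I_p) (fun i z => A z i (s i))
      (fun i => dA i (s i))) => //.
    exact: index_enum_uniq.
apply: is_derive_eq D _.
under eq_bigr do rewrite mulr_sumr.
rewrite exchange_big /=; apply: eq_bigr => i _.
(* The matrix whose determinant is the [i]-th term of the product rule. *)
pose B := \matrix_(a, b) (if a == i then dA i b else A x a b).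
transitivity (\det B).
  apply: eq_bigr => s _; congr (_ * _); rewrite [RHS](bigD1 i) //= !mxE eqxx.
  by congr (_ * _); apply: eq_bigr => j ji; rewrite !mxE (negbTE ji).
rewrite (expand_det_row B i); apply: eq_bigr => j _; rewrite !mxE eqxx; congr (_ * _).
rewrite /cofactor; congr (_ * \det _); apply/matrixP => a b; rewrite !mxE.
by rewrite eq_sym (negbTE (neq_lift i a)).
Qed.

Lemma cofactor_invmx p (A : 'M[R]_p) i j : A \in unitmx ->
  cofactor A i j = \det A * invmx A j i.
Proof.
move=> uA; rewrite /invmx uA !mxE mulrA divff ?mul1r //.
by rewrite -unitfE -unitmxE.
Qed.

(** The segment from the identity to [M] consists of definite matrices, hence
    of invertible ones, and the determinant, a polynomial of positive value at
    the identity, does not change sign along it. *)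
Lemma det_posdef_gt0 p (M : 'M[R]_p) :
  (forall xi : 'rV[R]_p, xi != 0 -> 0 < (xi *m M *m xi^T) 0 0) -> 0 < \det M.
Proof.
move=> Mpos.
pose Q : 'M[{poly R}]_p := \matrix_(i, j) ((i == j)%:R * 'X + (M i j)%:P * (1 - 'X)).
have Qs (s : R) : (\det Q).[s] = \det (s%:M + (1 - s) *: M).
  rewrite -horner_evalE -det_map_mx; congr (\det _); apply/matrixP => i j.
  rewrite !mxE /= horner_evalE !hornerE; case: (i == j) => /=; rewrite ?hornerE ?mulr1n ?mulr0n; ring.
have Q1 : (\det Q).[1] = 1 by rewrite Qs subrr scale0r addr0 det1.
have Q0 : (\det Q).[0] = \det M by rewrite Qs subr0 scale1r [X in X + _](_ : _ = 0) ?add0r // raddf0.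
have pos (s : R) (xi : 'rV[R]_p) : 0 <= s -> s <= 1 -> xi != 0 ->
    0 < (xi *m (s%:M + (1 - s) *: M) *m xi^T) 0 0.
  move=> s0 s1 xi0.
  have I0 : 0 < (xi *m xi^T) 0 0.
    rewrite mxE; have [i xii] := rV0Pn _ xi0.
    rewrite (bigD1 i) //= mxE; apply: ltr_wpDr.
      by apply: sumr_ge0 => j _; rewrite mxE -expr2 sqr_ge0.
    by rewrite -expr2 exprn_even_gt0.
  rewrite mulmxDr mulmxDl mul_mx_scalar -scalemxAl -scalemxAr -scalemxAl.
  rewrite mxE [X in X + _]mxE [X in _ + X]mxE.
  have M0 := Mpos _ xi0.
  move: s0; rewrite le_eqVlt => /predU1P[<-|s0].
    by rewrite mul0r add0r subr0 mul1r.
  by rewrite ltr_pwDl ?mulr_gt0 // mulr_ge0 ?subr_ge0 // ltW.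
have nz s : 0 <= s -> s <= 1 -> (\det Q).[s] != 0.
  move=> s0 s1; rewrite Qs; apply/negP => /det0P[xi xi0 E].
  by have := pos s xi s0 s1 xi0; rewrite E mul0mx mxE ltxx.
rewrite ltNge; apply/negP => d0.
have [|s /andP[s0 s1] /rootP rs] := @poly_ivt _ (\det Q) 0 1 ler01.
  by rewrite Q0 Q1 d0 ler01.
by have := nz s s0 s1; rewrite rs eqxx.
Qed.

Lemma gram_form p q (T : 'M[R]_(p, q)) (xi : 'rV[R]_p) :
  (xi *m (T *m T^T) *m xi^T) 0 0 = \sum_a ((xi *m T) 0 a) ^+ 2.
Proof.
rewrite mulmxA -mulmxA -trmx_mul mxE; apply: eq_bigr => a _.
by rewrite [X in _ * X]mxE expr2.
Qed.

Lemma gram_pos p q (T : 'M[R]_(p, q)) (xi : 'rV[R]_p) : row_free T -> xi != 0 ->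
  0 < (xi *m (T *m T^T) *m xi^T) 0 0.
Proof.
move=> fT xi0; rewrite gram_form lt_neqAle sumr_ge0 ?andbT => [|a _]; last exact: sqr_ge0.
rewrite eq_sym psumr_neq0 => [|a _]; last exact: sqr_ge0.
have : xi *m T != 0 by apply: contraNneq xi0 => /eqP; rewrite mulmx_free_eq0.
by move=> /rV0Pn[a ha]; apply/hasP; exists a; rewrite ?mem_index_enum //= exprn_even_gt0.
Qed.

Lemma det_gram_gt0 p q (T : 'M[R]_(p, q)) : row_free T -> 0 < \det (T *m T^T).
Proof. by move=> fT; apply: det_posdef_gt0 => xi; exact: gram_pos. Qed.

End Determinants.

(** * Euclidean norm and continuity of the closest point *)

Lemma continuous_at_distP (R : realType) (V W : normedModType R) (f : V -> W) (x : V) :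
  {for x, continuous f} <->
  forall e : R, 0 < e -> \forall z \near x, `|f x - f z| < e.
Proof. exact: (@cvgrPdist_lt R W _ (nbhs x) (nbhs_filter x) f (f x)). Qed.

Lemma normed_compact_closed (R : realType) (V : normedModType R) (A : set V) :
  compact A -> closed A.
Proof. by apply: compact_closed; exact: norm_hausdorff. Qed.

Section Euclid.
Variables (R : realType) (d : nat).
Implicit Types (x y z : 'rV[R]_d).

Definition dot x y : R := \sum_i x 0 i * y 0 i.

Lemma dotxx x : dot x x = enorm x ^+ 2.
Proof.
rewrite sqr_sqrtr; last by apply: sumr_ge0 => i _; exact: sqr_ge0.
by apply: eq_bigr => i _; rewrite expr2.
Qed.

Lemma dotC x y : dot x y = dot y x.
Proof. by apply: eq_bigr => i _; rewrite mulrC. Qed.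

Lemma dotDl x y z : dot (x + y) z = dot x z + dot y z.
Proof. by rewrite -big_split; apply: eq_bigr => i _; rewrite mxE mulrDl. Qed.

Lemma dotZl a x y : dot (a *: x) y = a * dot x y.
Proof. by rewrite mulr_sumr; apply: eq_bigr => i _; rewrite mxE mulrA. Qed.

Lemma dotDr x y z : dot z (x + y) = dot z x + dot z y.
Proof. by rewrite dotC dotDl !(dotC _ z). Qed.

Lemma dotZr a x y : dot x (a *: y) = a * dot x y.
Proof. by rewrite dotC dotZl dotC. Qed.

Lemma enorm_ge0 x : 0 <= enorm x.
Proof. exact: sqrtr_ge0. Qed.

Lemma enormZ a x : enorm (a *: x) = `|a| * enorm x.
Proof.
rewrite /enorm -sqrtr_sqr -sqrtrM ?sqr_ge0 // mulr_sumr; congr Num.sqrt.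
by apply: eq_bigr => i _; rewrite mxE exprMn.
Qed.

Lemma enormN x : enorm (- x) = enorm x.
Proof. by rewrite -scaleN1r enormZ normrN1 mul1r. Qed.

Lemma enormB x y : enorm (x - y) = enorm (y - x).
Proof. by rewrite -opprB enormN. Qed.

Lemma enorm0 : enorm (0 : 'rV[R]_d) = 0.
Proof. by rewrite -(scale0r 0) enormZ normr0 mul0r. Qed.

Lemma norm_le_enorm x : `|x| <= enorm x.
Proof.
apply: norm_rV_le => [|i]; first exact: enorm_ge0.
rewrite -(@ler_pXn2r _ 2) ?nnegrE ?enorm_ge0 // -dotxx real_normK ?num_real //.
rewrite /dot (bigD1 i) //= -expr2 lerDl; apply: sumr_ge0 => j _.
by rewrite -expr2 sqr_ge0.
Qed.

Lemma enorm_le_norm x : enorm x <= d%:R * `|x|.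
Proof.
rewrite -(@ler_pXn2r _ 2) ?nnegrE ?enorm_ge0 ?mulr_ge0 // -dotxx.
apply: (@le_trans _ _ (\sum_(i < d) `|x| ^+ 2)).
  apply: ler_sum => i _; rewrite -expr2 -real_normK ?num_real //.
  by rewrite ler_pXn2r ?nnegrE ?normr_ge0 // norm_coord_le.
rewrite sumr_const card_ord -[leLHS]mulr_natl exprMn ler_wpM2r ?sqr_ge0 //.
by rewrite -natrX ler_nat; case: d => // n; rewrite expnS expn1 leq_pmulr.
Qed.

Lemma enorm_eq0 x : enorm x = 0 -> x = 0.
Proof. by move=> x0; apply/normr0_eq0/eqP; rewrite eq_le normr_ge0 andbT -x0 norm_le_enorm. Qed.

(** The source of both the Cauchy-Schwarz inequality and its equality case. *)
Lemma lagrange_identity x y :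
  enorm (enorm y *: x - enorm x *: y) ^+ 2 =
  2 * (enorm x * enorm y) * (enorm x * enorm y - dot x y).
Proof.
rewrite -dotxx -scaleNr dotDl !dotDr !dotZl !dotZr !dotxx (dotC y x).
by ring.
Qed.

Lemma dot_le_enorm x y : dot x y <= enorm x * enorm y.
Proof.
have := lagrange_identity x y; have := sqr_ge0 (enorm (enorm y *: x - enorm x *: y)).
move=> + E; rewrite {}E.
have : 0 <= enorm x * enorm y by rewrite mulr_ge0 ?enorm_ge0.
rewrite le_eqVlt => /predU1P[/esym E|p0]; last first.
  by rewrite pmulr_rge0 ?subr_ge0 // mulr_gt0.
move=> _; rewrite E; have /eqP := E; rewrite mulf_eq0 => /orP[] /eqP /enorm_eq0 ->.
  by rewrite -(scale0r 0) dotZl mul0r.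
by rewrite -(scale0r 0) dotZr mul0r.
Qed.

Lemma enormD_sqr x y : enorm (x + y) ^+ 2 = enorm x ^+ 2 + 2 * dot x y + enorm y ^+ 2.
Proof. by rewrite -!dotxx dotDl !dotDr (dotC y x); ring. Qed.

Lemma ler_enormD x y : enorm (x + y) <= enorm x + enorm y.
Proof.
rewrite -(@ler_pXn2r _ 2) ?nnegrE ?addr_ge0 ?enorm_ge0 // enormD_sqr sqrrD.
by rewrite lerD2r lerD2l -[leRHS]mulr_natl ler_pM2l ?dot_le_enorm.
Qed.

Lemma enorm_triangle_eq x y : enorm x + enorm y <= enorm (x + y) ->
  enorm y *: x = enorm x *: y.
Proof.
rewrite -(@ler_pXn2r _ 2) ?nnegrE ?addr_ge0 ?enorm_ge0 // enormD_sqr sqrrD.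
rewrite lerD2r lerD2l -[leLHS]mulr_natl ler_pM2l // => xy.
apply/eqP; rewrite -subr_eq0; apply/eqP/enorm_eq0/eqP; rewrite -sqrf_eq0.
have -> := lagrange_identity x y.
by rewrite (@le_anti _ _ (dot x y) (enorm x * enorm y)) ?xy ?dot_le_enorm // subrr mulr0.
Qed.

Lemma enorm_near x (e : R) : 0 < e -> \forall z \near x, enorm (z - x) < e.
Proof.
move=> e0; apply/nbhs_ballP; exists (e / d.+1%:R) => /=; first by rewrite divr_gt0.
move=> z; rewrite -ball_normE /ball_ /= distrC => zx.
apply: le_lt_trans (enorm_le_norm _) _; apply: (@le_lt_trans _ _ (d.+1%:R * `|z - x|)).
  by rewrite ler_wpM2r // ler_nat.
by rewrite mulrC -ltr_pdivlMr.
Qed.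

Lemma enorm_continuous x : {for x, continuous (@enorm R d)}.
Proof.
apply/continuous_at_distP => e e0; near=> z.
have zx : enorm (z - x) < e by near: z; exact: enorm_near.
apply: le_lt_trans zx; rewrite ler_norml.
have A := ler_enormD (z - x) x; have B := ler_enormD (x - z) z.
rewrite subrK in A; rewrite subrK enormB in B.
by apply/andP; split; lra.
Unshelve. all: by end_near. Qed.

End Euclid.

Section ClosestPoint.
Variables (R : realType) (d : nat).
Variables (S Omega : set 'rV[R]_d) (cp : 'rV[R]_d -> 'rV[R]_d).

Lemma closest_le : closest_point_on S Omega cp -> forall x y, Omega x -> S y ->
  enorm (x - cp x) <= enorm (x - y).
Proof.
move=> hcp x y Ox Sy; have [_ H] := hcp x Ox.
by have [->|yx] := eqVneq y (cp x); [|exact/ltW/H].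
Qed.

Lemma closest_id : closest_point_on S Omega cp -> S `<=` Omega ->
  forall x, S x -> cp x = x.
Proof.
move=> hcp SO x Sx; have [_ H] := hcp x (SO x Sx); apply/eqP/negPn/negP => xn.
have := H x Sx; rewrite eq_sym xn subrr enorm0 => /(_ isT).
by rewrite ltNge enorm_ge0.
Qed.

(** Away from [cp x], the distance from [x] to the compact set [S] exceeds its
    minimum by a definite gap, which a small displacement of [x] cannot fill. *)
Lemma closest_point_continuous : compact S -> open Omega ->
  closest_point_on S Omega cp -> forall x, Omega x -> {for x, continuous cp}.
Proof.
move=> cS oO hcp x Ox; apply/continuous_at_distP => e e0.
have oOx : \forall z \near x, Omega z by exact: open_nbhs_nbhs.
pose K := S `&` ~` ball (cp x) e.
have cK : compact K.
  apply: (subclosed_compact _ cS); last by move=> ? [].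
  apply: closedI; first exact: normed_compact_closed.
  by apply: open_closedC; exact: ball_open.
have outK z : Omega z -> ~ K (cp z) -> `|cp x - cp z| < e.
  move=> Oz; have [Sz _] := hcp z Oz => nK; rewrite ltNge; apply/negP => ez.
  by apply: nK; split => //; rewrite -ball_normE /ball_ /= => /(le_lt_trans ez); rewrite ltxx.
have [K0|/set0P/negP/negPn/eqP K0] := pselect (K !=set0); last first.
  by near=> z; apply: outK; [near: z|rewrite K0].
have [|y yK ymin] := @EVT_min_rV R d (fun y => enorm (x - y)) K K0 cK.
  apply: continuous_subspaceT => y.
  apply: (@continuous_comp 'rV[R]_d 'rV[R]_d R (fun y => x - y) (@enorm R d));
    last exact: enorm_continuous.
  by apply: (@continuousB R 'rV[R]_d 'rV[R]_d (cst x) id); [exact: cst_continuous|exact: cvg_id].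
rewrite inE in yK; have [Sy yb] := yK.
have ycp : y != cp x.
  by apply/eqP => E; apply: yb; rewrite E; exact: ballxx.
pose m := enorm (x - y) - enorm (x - cp x).
have m0 : 0 < m by rewrite subr_gt0; have [_] := hcp x Ox; apply.
near=> z.
have Oz : Omega z by near: z.
have zx : enorm (z - x) < m / 2 by near: z; apply: enorm_near; rewrite divr_gt0.
apply: outK => // Kz.
have A := ymin _ (mem_set Kz).
have B := closest_le hcp Oz (hcp x Ox).1.
have C := ler_enormD (x - z) (z - cp z).
have D := ler_enormD (z - x) (x - cp x).
rewrite addrA subrK (enormB x z) in C; rewrite addrA subrK in D.
by move: zx; rewrite /m; lra.
Unshelve. all: by end_near. Qed.

End ClosestPoint.

(** * Closest points along a ray *)

Section RayExtension.
Variables (R : realType) (d : nat).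
Variables (S Omega : set 'rV[R]_d) (cp : 'rV[R]_d -> 'rV[R]_d).
Implicit Types x z : 'rV[R]_d.
Local Notation dist z := (enorm (z - cp z)).

Lemma enorm_sub_continuous (f : 'rV[R]_d -> 'rV[R]_d) z : {for z, continuous f} ->
  {for z, continuous (fun z : 'rV[R]_d => enorm (z - f z))}.
Proof.
move=> cf.
apply: (@continuous_comp 'rV[R]_d 'rV[R]_d R (fun z : 'rV[R]_d => z - f z) (@enorm R d));
  last exact: enorm_continuous.
by apply: (@continuousB R 'rV[R]_d 'rV[R]_d id f) => //; exact: cvg_id.
Qed.

Lemma enorm_sub_cst_continuous x : continuous (fun z : 'rV[R]_d => enorm (z - x)).
Proof. by move=> z; apply: (enorm_sub_continuous (f := cst x)); exact: cst_continuous. Qed.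

Lemma closed_enorm_preimage x (A : set R) :
  closed A -> closed [set z : 'rV[R]_d | A (enorm (z - x))].
Proof.
move=> cA; have := @closed_comp 'rV[R]_d R (fun z : 'rV[R]_d => enorm (z - x)) A.
by apply => // z _; exact: enorm_sub_cst_continuous.
Qed.

Lemma bounded_eball x (r : R) : bounded_set [set z : 'rV[R]_d | enorm (z - x) <= r].
Proof.
exists (r + `|x|); split; first exact: num_real.
move=> M rM z /= zr; apply: le_trans (ltW rM).
rewrite -[z in `|z|](subrK x); apply: le_trans (ler_normD _ _) _.
by rewrite lerD2r (le_trans (norm_le_enorm _)).
Qed.

Lemma compact_eball x (r : R) : compact [set z : 'rV[R]_d | enorm (z - x) <= r].
Proof.
apply: bounded_closed_compact; first exact: bounded_eball.
exact: (closed_enorm_preimage (@closed_le R r)).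
Qed.

Lemma compact_esphere x (r : R) : compact [set z : 'rV[R]_d | enorm (z - x) = r].
Proof.
apply: (subclosed_compact _ (@compact_eball x r)) => [|z /= ->//].
exact: (closed_enorm_preimage (@closed_eq R r)).
Qed.

(** Moving from [z] away from its closest point [cp z] by [h] increases the
    distance to [S] at a rate close to one, because the closest point hardly
    moves. *)
Lemma dist_increase z (c r : R) : compact S -> open Omega ->
  closest_point_on S Omega cp -> Omega z -> z != cp z -> 0 < c < 1 -> 0 < r ->
  exists2 h : R, 0 < h < r &
    exists2 w : 'rV[R]_d, enorm w = 1 & Omega (h *: w + z) -> dist z + c * h <= dist (h *: w + z).
Proof.
move=> cS oO hcp Oz zcp /andP[c0 c1] r0.
have d0 : 0 < dist z.
  rewrite lt_neqAle enorm_ge0 andbT eq_sym; apply: contra zcp => /eqP/enorm_eq0/eqP.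
  by rewrite subr_eq0.
(* If the closest point moves by less than [eta], its offset from [z] keeps an
   inner product at least [c * dist z] with the direction of displacement. *)
pose eta := (1 - c) * dist z.
have eta0 : 0 < eta by rewrite mulr_gt0 // subr_gt0.
have : \forall y \near z, enorm (cp y - cp z) < eta.
  have C := closest_point_continuous cS oO hcp Oz.
  have := enorm_near (cp z) eta0; exact: C.
move=> /nbhs_ballP[rho /= rho0 Hrho].
pose h := Num.min r rho / 2.
have m0 : 0 < Num.min r rho by rewrite lt_min r0.
have h0 : 0 < h by rewrite divr_gt0.
have : h < Num.min r rho by rewrite ltr_pdivrMr // mulr_natr mulr2n ltrDl.
rewrite lt_min => /andP[hr hrho].
exists h; first by rewrite h0.
pose w := (dist z)^-1 *: (z - cp z).
have w1 : enorm w = 1 by rewrite enormZ gtr0_norm ?invr_gt0 // mulVf ?gt_eqF.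
exists w => // Ohw; set y := h *: w + z; set q := cp y.
have qz : enorm (q - cp z) < eta.
  apply: Hrho; rewrite -ball_normE /ball_ /= distrC addrK normrZ (gtr0_norm h0).
  apply: le_lt_trans hrho; rewrite ger_pMr // -w1; exact: norm_le_enorm.
have dzq : dist z <= enorm (z - q) by apply: (closest_le hcp Oz); case: (hcp y Ohw).
have wq : dist z - eta <= dot w (z - q).
  have -> : z - q = (z - cp z) + (cp z - q) by rewrite addrA subrK.
  rewrite dotDr /w dotZl dotxx expr2 mulrA mulVf ?gt_eqF // mul1r lerD2l -/w.
  have := dot_le_enorm w (q - cp z); rewrite w1 mul1r => A.
  rewrite -[cp z - q]opprB -[- (q - cp z)]scaleN1r dotZr mulN1r lerN2; apply: le_trans A _; exact: ltW.
have s0 : 0 <= dist z + c * h by rewrite addr_ge0 ?enorm_ge0 ?mulr_ge0 ?(ltW c0) ?ltW.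
rewrite -(@ler_pXn2r _ 2) ?nnegrE ?enorm_ge0 ?s0 //.
have -> : y - q = (z - q) + h *: w by rewrite /y [RHS]addrC addrA.
rewrite enormD_sqr enormZ w1 mulr1 (gtr0_norm h0) (dotC (z - q)) dotZl.
have A : (dist z) ^+ 2 <= enorm (z - q) ^+ 2 by rewrite ler_pXn2r ?nnegrE ?enorm_ge0.
have B : h * (c * dist z) <= h * dot w (z - q).
  by rewrite ler_pM2l //; apply: le_trans wq; rewrite /eta; lra.
have C : (c * h) ^+ 2 <= h ^+ 2.
  by rewrite exprMn ger_pMl ?exprn_gt0 // expr_le1 ?ltW.
have -> : (dist z + c * h) ^+ 2 = dist z ^+ 2 + 2 * (h * (c * dist z)) + (c * h) ^+ 2 by ring.
by rewrite !lerD // ler_pM2l.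
Qed.

(** A maximizer of [dist z - c * |z - x|] over the ball cannot be interior, by
    the preceding lemma. *)
Lemma far_point_on_sphere x (r c : R) : compact S -> open Omega ->
  closest_point_on S Omega cp -> Omega x -> x != cp x -> 0 < r ->
  (forall z, enorm (z - x) <= r -> Omega z) -> 0 < c -> c < 1 ->
  exists2 z, enorm (z - x) = r & dist x + c * r <= dist z.
Proof.
move=> cS oO hcp Ox xcp r0 BO c0 c1.
pose B := [set z : 'rV[R]_d | enorm (z - x) <= r].
pose g (z : 'rV[R]_d) : R := dist z - c * enorm (z - x).
have Bx : B x by rewrite /B /= subrr enorm0 ltW.
have [|z zB zmax] := @EVT_max_rV R d g B (ex_intro _ x Bx) (@compact_eball x r).
  apply: continuous_in_subspaceT => z; rewrite inE => Bz.
  apply: (@continuousB R R^o 'rV[R]_d (fun z => dist z) (fun z => c * enorm (z - x))).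
    by apply: enorm_sub_continuous; exact: closest_point_continuous cS oO hcp _ (BO z Bz).
  apply: (@continuousM R 'rV[R]_d (cst c) (fun z => enorm (z - x))); first exact: cst_continuous.
  exact: enorm_sub_cst_continuous.
rewrite inE /B /= in zB.
have gx : dist x + c * enorm (z - x) <= dist z.
  have := zmax x (mem_set Bx); rewrite /g subrr enorm0 mulr0 subr0; lra.
suff zr : enorm (z - x) = r by exists z => //; rewrite -zr.
move: zB; rewrite le_eqVlt => /predU1P[//|zr]; exfalso.
have zcp : z != cp z.
  apply/eqP => E; move: gx; rewrite -E subrr enorm0 leNgt ltr_pwDl //.
    rewrite lt_neqAle enorm_ge0 andbT eq_sym; apply: contra xcp => /eqP/enorm_eq0/eqP.
    by rewrite subr_eq0.
  by rewrite mulr_ge0 ?enorm_ge0 ?ltW.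
(* Any slope strictly between [c] and one contradicts the maximality of [z]. *)
pose c' := (1 + c) / 2.
have c'01 : 0 < c' < 1 by apply/andP; split; rewrite /c'; lra.
have rz : 0 < r - enorm (z - x) by rewrite subr_gt0.
have [h /andP[h0 hr] [w w1 H]] := dist_increase cS oO hcp (BO z (ltW zr)) zcp c'01 rz.
have T : enorm (h *: w + z - x) <= h + enorm (z - x).
  have := ler_enormD (h *: w) (z - x).
  by rewrite addrA enormZ w1 mulr1 (gtr0_norm h0).
have Bh : enorm (h *: w + z - x) <= r by lra.
have := zmax _ (mem_set Bh); have := H (BO _ Bh); rewrite /g.
have : c * enorm (h *: w + z - x) <= c * (h + enorm (z - x)) by rewrite ler_pM2l.
have : c * h < c' * h by rewrite ltr_pM2r // /c'; lra.
lra.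
Qed.

(** The sphere of radius [r] about [x] carries a point at distance
    [dist x + r] from [S]; by the triangle inequality [cp x] is a closest point
    of [S] to it, and by the equality case it is on the ray from [cp x]
    through [x]. *)
Lemma closest_point_beyond x : compact S -> open Omega ->
  closest_point_on S Omega cp -> Omega x -> x != cp x ->
  exists2 t : R, 1 < t & forall q, S q ->
    enorm (t *: (x - cp x)) <= enorm (cp x + t *: (x - cp x) - q).
Proof.
move=> cS oO hcp Ox xcp.
have d0 : 0 < dist x.
  rewrite lt_neqAle enorm_ge0 andbT eq_sym; apply: contra xcp => /eqP/enorm_eq0/eqP.
  by rewrite subr_eq0.
have /nbhs_ballP[r' /= r'0 Hr'] := open_nbhs_nbhs (conj oO Ox).
pose r := r' / 2.
have r0 : 0 < r by rewrite divr_gt0.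
have rr : r < r' by rewrite ltr_pdivrMr // mulr_natr mulr2n ltrDl.
have BO z : enorm (z - x) <= r -> Omega z.
  move=> zr; apply: Hr'; rewrite -ball_normE /ball_ /= distrC.
  by apply: le_lt_trans rr; apply: le_trans zr; exact: norm_le_enorm.
have far := far_point_on_sphere cS oO hcp Ox xcp r0 BO.
have half0 : 0 < 2^-1 :> R by rewrite invr_gt0.
have half1 : 2^-1 < 1 :> R by rewrite invf_lt1 // ltr1n.
have [z0 z0r dz0] := far _ half0 half1.
have [|z zB zmax] := @EVT_max_rV R d (fun z => dist z) _ (ex_intro _ z0 z0r) (@compact_esphere x r).
  apply: continuous_in_subspaceT => z; rewrite inE => /= Bz.
  apply: enorm_sub_continuous; apply: closest_point_continuous cS oO hcp _ (BO z _).
  by rewrite Bz.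
rewrite inE /= in zB.
have dz : dist x + r <= dist z.
  rewrite leNgt; apply/negP => dz.
  have dz00 := zmax _ (mem_set z0r).
  (* The slope of [dist] from [x] to [z] is below one, and [c] is above it. *)
  pose c := ((dist z - dist x) / r + 1) / 2.
  have c12 : 2^-1 <= (dist z - dist x) / r by rewrite ler_pdivlMr //; lra.
  have c1 : (dist z - dist x) / r < 1 by rewrite ltr_pdivrMr //; lra.
  have cc0 : 0 < c by rewrite /c; lra.
  have cc1 : c < 1 by rewrite /c; lra.
  have [z1 z1r dz1] := far c cc0 cc1.
  have := le_trans dz1 (zmax _ (mem_set z1r)); apply/negP; rewrite -ltNge.
  rewrite -ltrBlDl -ltr_pdivrMr // /c; lra.
have Oz : Omega z by apply: BO; rewrite zB.
have zp := closest_le hcp Oz (hcp x Ox).1.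
have colin : enorm (z - x) *: (x - cp x) = dist x *: (z - x).
  apply: enorm_triangle_eq; rewrite zB.
  have -> : x - cp x + (z - x) = z - cp x by rewrite addrC addrA subrK.
  exact: le_trans dz zp.
have zE : z = cp x + (1 + r / dist x) *: (x - cp x).
  rewrite scalerDl scale1r addrA (addrC (cp x)) subrK mulrC -scalerA -zB colin.
  by rewrite scalerA mulVf ?gt_eqF // scale1r addrC subrK.
exists (1 + r / dist x); first by rewrite ltrDl divr_gt0.
move=> q Sq; rewrite -zE; apply: le_trans (closest_le hcp Oz Sq); apply: le_trans dz.
rewrite enormZ ger0_norm; last by rewrite addr_ge0 // divr_ge0 // ltW.
by rewrite mulrDl mul1r divfK ?gt_eqF.
Qed.

End RayExtension.

(** * The distance to a point in a parametrization *)

Section Chart.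
Variables (R : realType) (d k : nat) (S : set 'rV[R]_d) (U : set 'rV[R]_k).
Variable phi : 'rV[R]_k -> 'rV[R]_d.
Hypothesis paramSphi : local_param S U phi.
Local Notation T := (tangent_frame phi).
Local Notation e_ i := (delta_mx 0 i : 'rV[R]_k).

Lemma param_open : open U. Proof. by case: paramSphi. Qed.
Let oU := param_open.

Lemma param_in_surface y : U y -> S (phi y).
Proof.
move=> Uy; case: paramSphi => _ _ _ _ /(_ U oU (fun _ p => p))[W _ E].
by have [] : (S `&` W) (phi y) by rewrite -E; exists y.
Qed.

Lemma Ck_param m a : Ck m U (fun y => phi y 0 a).
Proof. by case: paramSphi => _ sm _ _ _; apply: Ck_coord => //; exact: sm. Qed.

Lemma Ck_frame m i a : Ck m U (fun y => T y i a).
Proof.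
case: paramSphi => _ sm _ _ _.
have C := Ck_coord a oU (Ck_partial i (sm m.+1)).
by apply: (eq_Ck oU _ C) => y _; rewrite mxE.
Qed.

Lemma partial_param y i a : U y -> partial i (fun z => phi z 0 a) y = T y i a.
Proof.
case: paramSphi => _ sm _ _ _ Uy; rewrite mxE partial_coord //.
exact: Ck_derivable (sm 1) Uy.
Qed.

Lemma is_derive_param y i a : U y ->
  is_derive y (e_ i) (fun z => phi z 0 a) (T y i a).
Proof. by move=> Uy; rewrite -(partial_param _ _ Uy); exact: Ck_is_derive (Ck_param 1 a) Uy. Qed.

Lemma metricE y i j : metric phi y i j = \sum_a T y i a * T y j a.
Proof. by rewrite mxE; apply: eq_bigr => a _; rewrite [X in _ * X]mxE. Qed.

(** Half of [|x - phi z|^2], as a function of [z], has gradient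
    [- normal_eq x z] and Hessian [dist_hessian x z]. *)
Definition normal_eq (x : 'rV[R]_d) (y : 'rV[R]_k) (i : 'I_k) : R :=
  \sum_a (x 0 a - phi y 0 a) * T y i a.

Definition dist_hessian (x : 'rV[R]_d) (y : 'rV[R]_k) : 'M[R]_k :=
  metric phi y -
  \matrix_(i, j) \sum_a (x 0 a - phi y 0 a) * partial j (fun z => T z i a) y.

Lemma is_derive_diff_param (x : 'rV[R]_d) y i a : U y ->
  is_derive y (e_ i) (fun z => x 0 a - phi z 0 a) (- T y i a).
Proof.
move=> Uy; have := is_deriveB (is_derive_cst (x 0 a) y (e_ i)) (is_derive_param i a Uy).
by rewrite sub0r.
Qed.

Lemma is_derive_normal_eq x y i j : U y ->
  is_derive y (e_ j) (normal_eq x ^~ i) (- dist_hessian x y i j).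
Proof.
move=> Uy; have D a := is_deriveM (is_derive_diff_param x j a Uy)
  (Ck_is_derive j (Ck_frame 1 i a) Uy).
apply: is_derive_eq (is_derive_sum_fun D) _.
rewrite [dist_hessian _ _]/dist_hessian mxE metricE mxE mxE opprB -sumrB.
by apply: eq_bigr => a _; rewrite /GRing.scale /= mulrN.
Qed.

Lemma Ck_normal_eq m x i : Ck m U (normal_eq x ^~ i).
Proof.
apply: Ck_sum => // a _; apply: CkM => //; last exact: Ck_frame.
by apply: CkB => //; [exact: Ck_cst|exact: Ck_param].
Qed.

Lemma chart_closest x y : U y ->
  (forall z, U z -> enorm (x - phi y) <= enorm (x - phi z)) ->
  (forall i, normal_eq x y i = 0) /\
  (forall xi : 'rV[R]_k, 0 <= (xi *m dist_hessian x y *m xi^T) 0 0).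
Proof.
move=> Uy ymin.
pose f z := \sum_a (x 0 a - phi z 0 a) * (x 0 a - phi z 0 a).
have Cd a : Ck 2 U (fun z => x 0 a - phi z 0 a).
  by apply: CkB => //; [exact: Ck_cst|exact: Ck_param].
have Cf : Ck 2 U f by apply: Ck_sum => // a _; apply: CkM.
have fE z : f z = enorm (x - phi z) ^+ 2.
  by rewrite -dotxx; apply: eq_bigr => a _; rewrite !mxE.
have fmin z : U z -> f y <= f z.
  by move=> Uz; rewrite !fE ler_pXn2r ?nnegrE ?enorm_ge0 // ymin.
have df z i : U z -> partial i f z = -2 * normal_eq x z i.
  move=> Uz; have D a := is_deriveM (is_derive_diff_param x i a Uz) (is_derive_diff_param x i a Uz).
  have [_ E] := is_derive_sum_fun D; rewrite /partial E mulr_sumr.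
  by apply: eq_bigr => a _; rewrite /GRing.scale /=; ring.
split=> [i|xi].
  have := partial_at_min i oU (CkW Cf) Uy fmin; rewrite df // => /eqP.
  by rewrite mulf_eq0 oppr_eq0 pnatr_eq0 => /eqP.
have := hessian_at_min xi oU Cf Uy fmin.
have -> : \sum_i \sum_j xi 0 i * xi 0 j * partial j (partial i f) y =
    2 * (xi *m dist_hessian x y *m xi^T) 0 0.
  rewrite mxE mulr_sumr exchange_big /=; apply: eq_bigr => j _.
  rewrite !mxE mulr_suml mulr_sumr; apply: eq_bigr => i _.
  have -> : partial j (partial i f) y = 2 * dist_hessian x y i j.
    rewrite (eq_partial j oU (fun z Uz => df z i Uz) Uy).
    have [_ E] := is_deriveZ (-2) (is_derive_normal_eq x i j Uy).
    by move: E; rewrite /partial => ->; rewrite /GRing.scale /= mulrNN.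
  by ring.
by rewrite pmulr_rge0.
Qed.

(** Some point [phi y + t (x - phi y)] with [1 < t] still has [phi y] as a
    closest point, so its Hessian is nonnegative; the Hessian being affine along
    the ray and equal to the metric at its origin, it is definite at [x]. *)
Lemma dist_hessian_pos Omega cp x y (xi : 'rV[R]_k) : compact S -> open Omega ->
  closest_point_on S Omega cp -> Omega x -> U y -> phi y = cp x -> xi != 0 ->
  0 < (xi *m dist_hessian x y *m xi^T) 0 0.
Proof.
move=> cS oO hcp Ox Uy yx xi0.
have fT : row_free (T y) by case: paramSphi => _ _ _ + _; exact.
have gpos := gram_pos fT xi0; rewrite -/(metric phi y) in gpos.
pose B := \matrix_(i, j) \sum_a (x 0 a - phi y 0 a) * partial j (fun z => T z i a) y.
have HE t : dist_hessian (cp x + t *: (x - cp x)) y = metric phi y - t *: B.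
  congr (_ - _); apply/matrixP => i j; rewrite !mxE mulr_sumr; apply: eq_bigr => a _.
  by rewrite -yx !mxE mulrA; congr (_ * _); ring.
have form t : (xi *m (metric phi y - t *: B) *m xi^T) 0 0 =
   (xi *m metric phi y *m xi^T) 0 0 - t * (xi *m B *m xi^T) 0 0.
  by rewrite mulmxBr mulmxBl -scalemxAr -scalemxAl mxE; congr (_ + _); rewrite !mxE.
have H1 : dist_hessian x y = metric phi y - 1 *: B by rewrite -HE scale1r addrC subrK.
rewrite H1 form mul1r.
have [E|xcp] := eqVneq x (cp x).
  have -> : B = 0.
    apply/matrixP => i j; rewrite !mxE; apply: big1 => a _.
    by rewrite yx -E subrr mul0r.
  by rewrite mulmx0 mul0mx [X in _ - X]mxE subr0.
have [t t1 far] := closest_point_beyond cS oO hcp Ox xcp.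
have [||_ /(_ xi)] := @chart_closest (cp x + t *: (x - cp x)) y => //.
  move=> z Uz; rewrite yx [X in enorm X <= _](_ : _ = t *: (x - cp x)); last first.
    by rewrite addrC addKr.
  by apply: far; exact: param_in_surface.
rewrite HE form; set b := (xi *m B *m _) _ _; set g := (xi *m metric _ _ *m _) _ _ in gpos *.
(* At the farther point the form is [g - t b >= 0], and [g < t g]. *)
move=> tb; rewrite subr_gt0 -(ltr_pM2l (lt_trans ltr01 t1)).
by apply: (@le_lt_trans _ _ g); [rewrite -subr_ge0|rewrite ltr_pMl].
Qed.

Lemma dist_hessian_unit Omega cp x y : compact S -> open Omega ->
  closest_point_on S Omega cp -> Omega x -> U y -> phi y = cp x ->
  dist_hessian x y \in unitmx.
Proof.
move=> cS oO hcp Ox Uy yx; rewrite unitmxE unitfE gt_eqF //.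
by apply: det_posdef_gt0 => xi xi0; exact: dist_hessian_pos cS oO hcp Ox Uy yx xi0.
Qed.

End Chart.

(** * Regularity of the closest point *)

(** A continuous solution [gamma] of an equation with invertible linear part
    (here normalized to minus the identity) is differentiable: the equation
    first bounds the increment of [gamma] linearly, and then determines it up
    to a negligible error. *)
Lemma is_derive_implicit (R : realType) (k : nat) (gamma beta : R -> 'rV[R]_k)
    (f : 'rV[R]_k -> 'rV[R]_k) :
  {for 0, continuous gamma} -> {for 0, continuous beta} ->
  (forall e : R, 0 < e ->
    \forall h \near (0 : 'rV[R]_k), `|f (h + gamma 0) + h| <= e * `|h|) ->
  (\forall s \near (0 : R), f (gamma s) = - (s *: beta s)) ->
  is_derive (0 : R) (1 : R) gamma (beta 0).
Proof.
move=> cg cb fh feq.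
suff L : h^-1 *: ((gamma \o shift 0) (h *: (1 : R)) - gamma 0) @[h --> 0^'] --> beta 0.
  by split; [apply/cvg_ex; exists (beta 0)|exact: cvg_lim].
have b1 : 0 < `|beta 0| + 1 by rewrite ltr_wpDl.
apply/cvgrPdist_le => e e0.
(* The bound [2^-1] lets the increment absorb its own contribution to the error
   term; the other one brings the remaining error below [e / 2]. *)
pose eps := Num.min 2^-1 (e / (4 * (`|beta 0| + 1))).
have eps0 : 0 < eps.
  by rewrite lt_min invr_gt0 ltr0n divr_gt0 // mulr_gt0.
have e20 : 0 < e / 2 by rewrite divr_gt0.
have N1 : \forall s \near (0 : R),
    `|f (gamma s) + (gamma s - gamma 0)| <= eps * `|gamma s - gamma 0|.
  have /nbhs_ballP[r /= r0 Hr] := fh eps eps0.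
  have := (continuous_at_distP gamma 0).1 cg r r0; apply: filterS => s sr.
  have := Hr (gamma s - gamma 0); rewrite -ball_normE /ball_ /= sub0r normrN distrC sr subrK.
  exact.
have N2 := (continuous_at_distP beta 0).1 cb _ e20.
have N3 := (continuous_at_distP beta 0).1 cb _ ltr01.
near=> s.
have s0 : s != 0 by near: s; exact: nbhs_dnbhs_neq.
have E0 : f (gamma s) = - (s *: beta s) by near: s; exact: nbhs_dnbhs.
have E1 : `|f (gamma s) + (gamma s - gamma 0)| <= eps * `|gamma s - gamma 0|.
  by near: s; exact: nbhs_dnbhs.
have E2 : `|beta 0 - beta s| < e / 2 by near: s; exact: nbhs_dnbhs.
have E3 : `|beta 0 - beta s| < 1 by near: s; exact: nbhs_dnbhs.
rewrite /= addr0 (_ : s *: (1 : R) = s); last exact: mulr1.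
have sp : 0 < `|s| by rewrite normr_gt0.
set h := gamma s - gamma 0 in E1 *.
rewrite E0 in E1.
have bs : `|beta s| <= `|beta 0| + 1.
  have := ler_normB (beta 0) (beta 0 - beta s); rewrite opprB addrC subrK => A.
  by apply: le_trans A _; rewrite lerD2l ltW.
have hs : `|h| <= 2 * `|s| * (`|beta 0| + 1).
  have A : `|h| <= `|- (s *: beta s) + h| + `|s *: beta s|.
    by have := ler_normD (- (s *: beta s) + h) (s *: beta s); rewrite addrAC addNr add0r.
  have B : eps * `|h| <= 2^-1 * `|h| by rewrite ler_wpM2r // ge_min lexx.
  have C : `|s *: beta s| <= `|s| * (`|beta 0| + 1) by rewrite normrZ ler_pM2l.
  by move: A B C E1; lra.
clearbody h.
have -> : beta 0 - s^-1 *: h = (beta 0 - beta s) - s^-1 *: (- (s *: beta s) + h).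
  by rewrite scalerDr scalerN scalerA mulVf // scale1r opprD opprK addrA subrK.
apply: le_trans (ler_normB _ _) _; rewrite [leRHS]splitr; apply: lerD; first exact: ltW.
rewrite normrZ normfV ler_pdivrMl //; apply: le_trans E1 _.
apply: le_trans (ler_wpM2l (ltW eps0) hs) _.
rewrite (_ : eps * _ = `|s| * (eps * (2 * (`|beta 0| + 1)))); last by ring.
rewrite ler_pM2l //.
have : eps <= e / (4 * (`|beta 0| + 1)) by rewrite ge_min lexx orbT.
rewrite ler_pdivlMr ?mulr_gt0 // => A; lra.
Unshelve. all: by end_near. Qed.

Section ClosestPointCoordinates.
Variables (R : realType) (d k : nat) (S Omega : set 'rV[R]_d).
Variables (cp : 'rV[R]_d -> 'rV[R]_d).
Variables (U : set 'rV[R]_k) (phi : 'rV[R]_k -> 'rV[R]_d).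
Hypothesis paramSphi : local_param S U phi.
Hypothesis compactS : compact S.
Hypothesis openO : open Omega.
Hypothesis cpP : closest_point_on S Omega cp.
Local Notation T := (tangent_frame phi).
Let openU : open U := param_open paramSphi.

Definition chart_domain : set 'rV[R]_d := [set x | Omega x /\ (phi @` U) (cp x)].

(** The preimage of [cp x] under [phi]; an arbitrary point outside of
    [chart_domain]. *)
Definition chart_coord (x : 'rV[R]_d) : 'rV[R]_k := get [set y | U y /\ phi y = cp x].

Lemma chart_coordP x : chart_domain x -> U (chart_coord x) /\ phi (chart_coord x) = cp x.
Proof. by case=> _ [y Uy yx]; apply: (@getPex _ [set y | U y /\ phi y = cp x]); exists y. Qed.

Lemma chart_coord_eq x y : U y -> phi y = cp x -> Omega x -> chart_coord x = y.
Proof.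
move=> Uy yx Ox; have [|Uc cx] := @chart_coordP x; first by split => //; exists y.
by case: paramSphi => _ _ inj _ _; apply: inj => //; rewrite cx.
Qed.

Lemma near_closest (V : set 'rV[R]_k) x : open V -> V `<=` U -> Omega x ->
  (phi @` V) (cp x) -> \forall z \near x, Omega z /\ (phi @` V) (cp z).
Proof.
move=> oV VU Ox Vx; case: paramSphi => _ _ _ _ /(_ V oV VU)[W oW E].
have cW : \forall z \near x, W (cp z).
  have C := closest_point_continuous compactS openO cpP Ox.
  apply: C; apply: open_nbhs_nbhs; split => //.
  by have [] : (S `&` W) (cp x) by rewrite -E.
have cO : \forall z \near x, Omega z by exact: open_nbhs_nbhs.
near=> z; have Oz : Omega z by near: z.
split=> //; rewrite E; split; first by case: (cpP Oz).
by near: z.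
Unshelve. all: by end_near. Qed.

Lemma open_chart_domain : open chart_domain.
Proof. by rewrite openE => x [Ox Ux]; exact: near_closest. Qed.

Lemma chart_coord_continuous x : chart_domain x -> {for x, continuous chart_coord}.
Proof.
move=> Dx; have [Ux cx] := chart_coordP Dx; have [Ox _] := Dx.
apply/continuous_at_distP => e e0.
pose V := U `&` ball (chart_coord x) e.
have oV : open V by apply: openI => //; exact: ball_open.
have VU : V `<=` U by move=> y [].
have Vx : (phi @` V) (cp x) by exists (chart_coord x) => //; split=> //; exact: ballxx.
have := near_closest oV VU Ox Vx.
apply: filterS => z [Oz [y [Uy yb] yz]].
by rewrite (chart_coord_eq Uy yz Oz); move: yb; rewrite -ball_normE.
Qed.

Lemma chart_coord_normal x i : chart_domain x -> normal_eq phi x (chart_coord x) i = 0.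
Proof.
move=> Dx; have [Ux cx] := chart_coordP Dx; have [Ox _] := Dx.
have [|H _] := chart_closest paramSphi (x := x) Ux; last exact: H.
move=> z Uz; rewrite cx; apply: (closest_le cpP Ox).
exact: (param_in_surface paramSphi Uz).
Qed.

Let hess x := dist_hessian phi x (chart_coord x).

Lemma hess_unit x : chart_domain x -> hess x \in unitmx.
Proof.
move=> Dx; have [Ux cx] := chart_coordP Dx; have [Ox _] := Dx.
exact: (dist_hessian_unit paramSphi compactS openO cpP Ox Ux cx).
Qed.

(** The implicit function theorem for the equations [normal_eq x y = 0], whose
    derivative in [y] is minus the Hessian and whose derivative in [x] is the
    tangent frame. *)
Lemma is_derive_chart_coord x a : chart_domain x ->
  is_derive x (delta_mx 0 a) chart_coord
    (\row_j (invmx (hess x) *m T (chart_coord x)) j a).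
Proof.
move=> Dx; have [Ux cx] := chart_coordP Dx.
set y := chart_coord x in Ux cx *.
pose v : 'rV[R]_d := delta_mx 0 a.
pose gamma (s : R) := chart_coord (s *: v + x).
pose beta (s : R) : 'rV[R]_k := \row_j (invmx (hess x) *m T (gamma s)) j a.
(* Multiplying by the inverse Hessian normalizes the linear part. *)
pose f (z : 'rV[R]_k) : 'rV[R]_k :=
  \row_j \sum_i invmx (hess x) j i * normal_eq phi x z i.
have g0 : gamma 0 = y by rewrite /gamma scale0r add0r.
have cl : {for (0 : R), continuous (fun s : R => s *: v + x)}.
  apply: (@continuousD R 'rV[R]_d R (fun s : R => s *: v) (cst x)); last exact: cst_continuous.
  exact: scalel_continuous.
have cgamma : {for 0, continuous gamma}.
  apply: (@continuous_comp R 'rV[R]_d 'rV[R]_k (fun s : R => s *: v + x) chart_coord) => //.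
  by rewrite scale0r add0r; exact: chart_coord_continuous.
have D : is_derive (0 : R) (1 : R) gamma (beta 0).
  apply: (@is_derive_implicit R k gamma beta f cgamma).
  - apply: continuous_rV => j.
    have -> : (fun s => beta s 0 j) = (fun z => \sum_i invmx (hess x) j i * T z i a) \o gamma.
      by apply/funext => s; rewrite /= !mxE.
    apply: continuous_comp => //; rewrite g0.
    have C : Ck 0 U (fun z => \sum_i invmx (hess x) j i * T z i a).
      by apply: Ck_sum => // i _; apply: CkZ => //; exact: (Ck_frame paramSphi).
    exact: Ck_continuous C Ux.
  - move=> e e0.
    have N j : \forall h \near (0 : 'rV[R]_k), `|f (h + gamma 0) 0 j + h 0 j| <= e * `|h|.
      pose fj z := \sum_i invmx (hess x) j i * normal_eq phi x z i.
      have Cfj : Ck 1 U fj.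
        by apply: Ck_sum => // i _; apply: CkZ => //; exact: (Ck_normal_eq paramSphi).
      have dfj := Ck_differentiable openU Cfj Ux.
      have fy : fj y = 0.
        apply: big1 => i _.
        by have -> : normal_eq phi x y i = 0; [exact: chart_coord_normal|exact: mulr0].
      have dE h : 'd fj y h = - h 0 j.
        rewrite -deriveE // derive_partial //.
        have pE l : partial l fj y = - (l == j)%:R.
          have DD i := is_deriveZ (invmx (hess x) j i) (is_derive_normal_eq paramSphi x i l Ux).
          have [_] := is_derive_sum_fun DD; rewrite /partial => ->.
          transitivity (- (invmx (hess x) *m hess x) j l); last first.
            by rewrite mulVmx ?hess_unit // mxE eq_sym.
          by rewrite mxE -sumrN; apply: eq_bigr => i _; rewrite scalerN.
        rewrite (bigD1 j) //= pE eqxx mulrN1 big1 ?addr0 // => l lj.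
        by rewrite pE (negbTE lj) oppr0 mulr0.
      have [r r0 Hr] := diff_estimate dfj e0.
      apply/nbhs_ballP; exists r => // h; rewrite -ball_normE /ball_ /= sub0r normrN => hr.
      by have := Hr h hr; rewrite fy subr0 dE opprK g0 /f mxE.
    have {}N : \forall h \near (0 : 'rV[R]_k), forall j, `|f (h + gamma 0) 0 j + h 0 j| <= e * `|h|.
      by near=> h => j; move: j; near: h; apply: filter_forall => j; exact: N.
    apply: filterS N => h Hh; apply: norm_rV_le => [|j]; first by rewrite mulr_ge0 // ltW.
    by rewrite mxE.
  - have Nd : \forall s \near (0 : R), chart_domain (s *: v + x).
      have := open_nbhs_nbhs (conj open_chart_domain Dx).
      by rewrite -[X in nbhs X](add0r x) -(scale0r v); exact: cl.
    apply: filterS Nd => s Ds; apply/rowP => j; rewrite !mxE mulr_sumr -sumrN.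
    apply: eq_bigr => i _.
    have A : normal_eq phi (s *: v + x) (gamma s) i =
        s * T (gamma s) i a + normal_eq phi x (gamma s) i.
      rewrite /normal_eq; under eq_bigr do rewrite mxE -addrA mulrDl.
      rewrite big_split /= (bigD1 a) //= big1 ?addr0 => [|b ba]; last first.
        by rewrite !mxE (negbTE ba) andbF mulr0 mul0r.
      by rewrite !mxE !eqxx mulr1.
    have := chart_coord_normal i Ds; rewrite -/(gamma s) A => /eqP.
    by rewrite addrC addr_eq0 => /eqP ->; ring.
have dY : derivable chart_coord x v.
  by apply/derivable1P; case: D.
split=> //; have [|_] := @is_derive_line _ _ _ chart_coord x v 0.
  by rewrite scale0r add0r.
rewrite scale0r add0r => <-; case: D => _ ->.
by rewrite /beta g0.
Unshelve. all: by end_near. Qed.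

Lemma is_derive_chart_coord_entry x a j : chart_domain x ->
  is_derive x (delta_mx 0 a) (fun z => chart_coord z 0 j)
   (\sum_i invmx (hess x) j i * T (chart_coord x) i a).
Proof.
move=> Dx; have [d1 d2] := is_derive_chart_coord a Dx.
split; first by have /derivable_mxP := d1; apply.
have := derive_mx d1; rewrite d2 => /(congr1 (fun M : 'rV[R]_k => M 0 j)).
by rewrite !mxE => <-.
Qed.

Lemma Ck_hess_entry m i j : (forall l, Ck m chart_domain (fun x => chart_coord x 0 l)) ->
  Ck m chart_domain (fun x => hess x i j).
Proof.
move=> CY; have oD := open_chart_domain.
have UD x : chart_domain x -> U (chart_coord x) by case/chart_coordP.
have comp (f : 'rV[R]_k -> R) : Ck m U f -> Ck m chart_domain (f \o chart_coord).
  by move=> Cf; apply: Ck_comp Cf CY.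
have C : Ck m chart_domain (fun x =>
    \sum_a (T (chart_coord x) i a * T (chart_coord x) j a) -
    \sum_a (x 0 a - phi (chart_coord x) 0 a) * partial j (fun z => T z i a) (chart_coord x)).
  apply: CkB => //; apply: Ck_sum => // a _; apply: CkM => //.
  - exact: comp (Ck_frame paramSphi m i a).
  - exact: comp (Ck_frame paramSphi m j a).
  - apply: CkB => //; first exact: Ck_id_coord.
    exact: comp (Ck_param paramSphi m a).
  - exact: comp (Ck_partial j (Ck_frame paramSphi m.+1 i a)).
by apply: (eq_Ck oD _ C) => x _; rewrite /hess /dist_hessian [RHS]mxE metricE !mxE.
Qed.

Lemma Ck_invhess_entry m i j : (forall l, Ck m chart_domain (fun x => chart_coord x 0 l)) ->
  Ck m chart_domain (fun x => invmx (hess x) i j).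
Proof.
move=> CY; apply: Ck_invmx => [||i' j']; first exact: open_chart_domain.
  exact: hess_unit.
exact: Ck_hess_entry.
Qed.

(** Bootstrap: the derivative of the coordinates is an algebraic expression in
    [x] and in derivatives of [phi] evaluated at the coordinates themselves, so
    it is as regular as the coordinates are. *)
Lemma Ck_chart_coord m j : Ck m chart_domain (fun x => chart_coord x 0 j).
Proof.
have oD := open_chart_domain.
have cY l x : chart_domain x -> {for x, continuous (fun x => chart_coord x 0 l)}.
  move=> Dx; apply: (@continuous_comp _ _ _ chart_coord (fun M : 'rV[R]_k => M 0 l)).
    exact: chart_coord_continuous.
  exact: coord_continuous.
elim: m j => [|m IH] j; split=> //; [exact: cY|exact: cY|move=> a].
split=> [x Dx|]; first by case: (is_derive_chart_coord_entry a j Dx).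
have C : Ck m chart_domain (fun x => \sum_i invmx (hess x) j i * T (chart_coord x) i a).
  apply: Ck_sum => // i _; apply: CkM => //; first exact: Ck_invhess_entry.
  apply: (Ck_comp (G := chart_coord) oD openU _ (Ck_frame paramSphi m i a) IH).
  by move=> x /chart_coordP[].
by apply: (eq_Ck oD _ C) => x Dx; case: (is_derive_chart_coord_entry a j Dx).
Qed.

Lemma Ck_comp_cp m (u : 'rV[R]_d -> R) : Ck m U (u \o phi) -> Ck m chart_domain (u \o cp).
Proof.
move=> Cu; have oD := open_chart_domain.
have UD x : chart_domain x -> U (chart_coord x) by case/chart_coordP.
apply: (eq_Ck oD _ (Ck_comp oD openU UD Cu (Ck_chart_coord m))) => x Dx.
by have [_] := chart_coordP Dx; rewrite /= => ->.
Qed.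

End ClosestPointCoordinates.

Lemma C2_comp_closest_point (R : realType) (d k : nat) (S Omega : set 'rV[R]_d)
    (cp : 'rV[R]_d -> 'rV[R]_d) (u : 'rV[R]_d -> R) :
  closed_surface k S -> open Omega -> closest_point_on S Omega cp ->
  C2_on k S u -> Ck 2 Omega (u \o cp).
Proof.
move=> [cS charts] oO hcp Cu; apply: Ck_local => x Ox.
have [Sx _] := hcp x Ox; have [U [phi [P Ux]]] := charts _ Sx.
exists (chart_domain Omega cp U phi); first by split.
exact: Ck_comp_cp P cS oO hcp _ _ (Cu _ _ P).
Qed.

(** * The Laplace-Beltrami operator in coordinates *)

Lemma is_derive_sqrt_comp (R : realType) (V : normedModType R) (f : V -> R) (df : R)
    (x v : V) : is_derive x v f df -> 0 < f x ->
  is_derive x v (fun z => Num.sqrt (f z)) ((2 * Num.sqrt (f x))^-1 * df).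
Proof.
move=> [d1 d2] f0; have D := is_derive1_sqrt f0.
have ds : differentiable (@Num.sqrt R) (f x) by apply/derivable1_diffP; case: D.
apply: is_derive_eq (is_derive_comp ds d1) _.
rewrite d2 deriveE // -[df in LHS]mulr1 -[df * 1]/(df *: (1 : R)) linearZ_LR -deriveE //.
by case: D => _ ->; exact: mulrC.
Qed.

Section LaplaceBeltrami.
Variables (R : realType) (d k : nat) (S : set 'rV[R]_d).
Variables (U : set 'rV[R]_k) (phi : 'rV[R]_k -> 'rV[R]_d).
Hypothesis paramSphi : local_param S U phi.
Local Notation T := (tangent_frame phi).
Local Notation ginv y := (invmx (metric phi y)).
Let openU : open U := param_open paramSphi.

Lemma metric_unit y : U y -> metric phi y \in unitmx.
Proof.
move=> Uy; rewrite unitmxE unitfE gt_eqF // det_gram_gt0 //.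
by case: paramSphi => _ _ _ + _; exact.
Qed.

Lemma ginvC y i j : ginv y i j = ginv y j i.
Proof.
rewrite -[in LHS](trmxK (ginv y)) mxE trmx_inv /metric trmx_mul trmxK.
by [].
Qed.

Lemma Ck_metric m i j : Ck m U (fun y => metric phi y i j).
Proof.
have C : Ck m U (fun y => \sum_a T y i a * T y j a).
  by apply: Ck_sum => // a _; apply: CkM => //; exact: (Ck_frame paramSphi).
by apply: (eq_Ck openU _ C) => y _; rewrite metricE.
Qed.

Lemma partial_frameC y i l a : U y ->
  partial i (fun z => T z l a) y = partial l (fun z => T z i a) y.
Proof.
move=> Uy; have := partialC i l openU (Ck_param paramSphi 2 a) Uy.
rewrite (eq_partial i openU (fun z Uz => partial_param paramSphi l a Uz) Uy) => ->.
by rewrite (eq_partial l openU (fun z Uz => partial_param paramSphi i a Uz) Uy).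
Qed.

(** The trace [g^lm <d_l T_i, T_m>], which is the partial derivative of the
    logarithm of the volume density [sqrt (det g)]. *)
Definition log_density_partial (y : 'rV[R]_k) (i : 'I_k) : R :=
  \sum_l \sum_m ginv y l m * \sum_a partial l (fun z => T z i a) y * T y m a.

(** Jacobi's formula produces [g^lm d_i g_lm / 2 = g^lm <d_i T_l, T_m>]; the
    indices [i] and [l] are exchanged by the symmetry of second derivatives. *)
Lemma is_derive_density y i : U y ->
  is_derive y (delta_mx 0 i) (fun z => Num.sqrt (\det (metric phi z)))
    (Num.sqrt (\det (metric phi y)) * log_density_partial y i).
Proof.
move=> Uy; pose pT l a := partial i (fun z => T z l a) y.
have fT : row_free (T y) by case: paramSphi => _ _ _ + _; exact.
have det0 : 0 < \det (metric phi y) by exact: det_gram_gt0.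
pose dg : 'M[R]_k := \matrix_(l, m) \sum_a (pT l a * T y m a + T y l a * pT m a).
have Dg l m : is_derive y (delta_mx 0 i) (fun z => metric phi z l m) (dg l m).
  have -> : (fun z => metric phi z l m) = (fun z => \sum_a T z l a * T z m a).
    by apply/funext => z; rewrite metricE.
  have D a := is_deriveM (Ck_is_derive i (Ck_frame paramSphi 1 l a) Uy)
    (Ck_is_derive i (Ck_frame paramSphi 1 m a) Uy).
  apply: is_derive_eq (is_derive_sum_fun D) _; rewrite mxE.
  by apply: eq_bigr => a _; rewrite addrC; congr (_ + _); exact: mulrC.
apply: is_derive_eq (is_derive_sqrt_comp (is_derive_det Dg) det0) _.
have -> : \sum_l \sum_m dg l m * cofactor (metric phi y) l m =
    \det (metric phi y) * (2 * log_density_partial y i).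
  transitivity (\det (metric phi y) * \sum_l \sum_m ginv y l m * dg l m).
    rewrite mulr_sumr; apply: eq_bigr => l _; rewrite mulr_sumr; apply: eq_bigr => m _.
    by rewrite cofactor_invmx ?metric_unit // ginvC; ring.
  have logC : log_density_partial y i =
      \sum_l \sum_m ginv y m l * \sum_a partial m (fun z => T z i a) y * T y l a.
    exact: exchange_big.
  congr (_ * _); rewrite mulr_natl mulr2n {2}logC /log_density_partial -big_split /=.
  apply: eq_bigr => l _; rewrite -big_split; apply: eq_bigr => m _ /=.
  rewrite (ginvC y m l) -mulrDr mxE -big_split; congr (_ * _); apply: eq_bigr => a _ /=.
  by rewrite /pT (partial_frameC i l a Uy) (partial_frameC i m a Uy); congr (_ + _); exact: mulrC.
set s := Num.sqrt _; have s0 : 0 < s by rewrite sqrtr_gt0.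
have -> : \det (metric phi y) = s ^+ 2 by rewrite sqr_sqrtr // ltW.
by field; rewrite gt_eqF.
Qed.

(** The contravariant components of the gradient of [f]. *)
Definition coord_gradient (f : 'rV[R]_k -> R) (y : 'rV[R]_k) (i : 'I_k) : R :=
  \sum_j ginv y i j * partial j f y.

Lemma Ck_coord_gradient m f i : Ck m.+1 U f -> Ck m U (coord_gradient f ^~ i).
Proof.
move=> Cf; apply: Ck_sum => // j _; apply: CkM => //; last exact: Ck_partial.
by apply: Ck_invmx => // [y Uy|i' j']; [exact: metric_unit|exact: Ck_metric].
Qed.

Lemma coord_laplace_beltramiE f y : Ck 2 U f -> U y ->
  coord_laplace_beltrami phi f y =
  \sum_i (partial i (coord_gradient f ^~ i) y +
          coord_gradient f y i * log_density_partial y i).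
Proof.
move=> Cf Uy; have fT : row_free (T y) by case: paramSphi => _ _ _ + _; exact.
have s0 : 0 < Num.sqrt (\det (metric phi y)) by rewrite sqrtr_gt0 det_gram_gt0.
rewrite /coord_laplace_beltrami mulr_sumr; apply: eq_bigr => i _.
have D := is_deriveM (is_derive_density i Uy) (Ck_is_derive i (Ck_coord_gradient i Cf) Uy).
have [_ E] := D.
rewrite /partial [X in _ * X]E -/(partial i _ _) mulrDr.
congr (_ + _); rewrite [X in _ * X]/GRing.scale /=; first by rewrite mulKf // gt_eqF.
by rewrite mulrCA mulKf // gt_eqF.
Qed.

End LaplaceBeltrami.

(** * The Laplacian on the surface and the embedded problem *)

Section LaplacianOnSurface.
Variables (R : realType) (d k : nat) (S Omega : set 'rV[R]_d).
Variables (cp : 'rV[R]_d -> 'rV[R]_d).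
Variables (U : set 'rV[R]_k) (phi : 'rV[R]_k -> 'rV[R]_d).
Hypothesis paramSphi : local_param S U phi.
Hypothesis compactS : compact S.
Hypothesis openO : open Omega.
Hypothesis SO : S `<=` Omega.
Hypothesis cpP : closest_point_on S Omega cp.
Local Notation T := (tangent_frame phi).
Local Notation Y := (chart_coord cp U phi).
Local Notation D := (chart_domain Omega cp U phi).
Local Notation hess x := (dist_hessian phi x (Y x)).
Local Notation ginv y := (invmx (metric phi y)).
Let openU : open U := param_open paramSphi.
Let openD : open D := open_chart_domain paramSphi compactS openO cpP.

Lemma cp_param y : U y -> cp (phi y) = phi y.
Proof. by move=> Uy; apply: closest_id cpP SO _ _; exact: (param_in_surface paramSphi). Qed.

Lemma param_in_domain y : U y -> D (phi y).
Proof.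
move=> Uy; split; first by apply: SO; exact: (param_in_surface paramSphi).
by rewrite cp_param //; exists y.
Qed.

Lemma chart_coord_param y : U y -> Y (phi y) = y.
Proof.
move=> Uy; apply: (chart_coord_eq (Omega := Omega) paramSphi Uy); first by rewrite cp_param.
by apply: SO; exact: (param_in_surface paramSphi).
Qed.

Lemma dist_hessian_param y : dist_hessian phi (phi y) y = metric phi y.
Proof.
rewrite /dist_hessian [X in _ - X](_ : _ = 0) ?subr0 //.
by apply/matrixP => i j; rewrite !mxE; apply: big1 => a _; rewrite subrr mul0r.
Qed.

Variable u : 'rV[R]_d -> R.
Hypothesis Cu : Ck 2 U (u \o phi).
Let f := u \o phi.

(** The components of the gradient of [u \o cp] at [x] in the tangent frame at
    [cp x]; off the surface, the Hessian takes the place of the metric. *)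
Definition frame_gradient (x : 'rV[R]_d) (i : 'I_k) : R :=
  \sum_j invmx (hess x) j i * partial j f (Y x).

Lemma Ck_compY m (h : 'rV[R]_k -> R) : Ck m U h -> Ck m D (h \o Y).
Proof.
move=> Ch; apply: (Ck_comp openD openU _ Ch).
  by move=> x /(chart_coordP)[].
exact: (Ck_chart_coord paramSphi compactS openO cpP m).
Qed.

Lemma Ck_frame_gradient i : Ck 1 D (frame_gradient ^~ i).
Proof.
apply: Ck_sum => // j _; apply: CkM => //; last exact: Ck_compY (Ck_partial j Cu).
apply: (Ck_invhess_entry paramSphi compactS openO cpP) => l.
exact: (Ck_chart_coord paramSphi compactS openO cpP).
Qed.

Lemma partial_comp_cp x a : D x ->
  partial a (u \o cp) x = \sum_i frame_gradient x i * T (Y x) i a.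
Proof.
move=> Dx; have UYx : U (Y x) by case: (chart_coordP Dx).
have E z : D z -> (u \o cp) z = (f \o Y) z.
  by move=> /chart_coordP[_ Yz]; rewrite /f /= Yz.
rewrite (eq_partial a openD E Dx).
rewrite (partial_comp a openD openU UYx Dx Cu); last first.
  exact: (Ck_chart_coord paramSphi compactS openO cpP 2).
transitivity (\sum_j \sum_i partial j f (Y x) * (invmx (hess x) j i * T (Y x) i a)).
  apply: eq_bigr => j _; rewrite -mulr_sumr; congr (_ * _).
  by case: (is_derive_chart_coord_entry paramSphi compactS openO cpP a j Dx).
rewrite exchange_big; apply: eq_bigr => i _ /=; rewrite mulr_suml.
by apply: eq_bigr => j _; ring.
Qed.

Lemma frame_gradient_param y i : U y -> frame_gradient (phi y) i = coord_gradient phi f y i.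
Proof.
move=> Uy; apply: eq_bigr => j _.
by rewrite chart_coord_param // dist_hessian_param ginvC.
Qed.

(** Both terms of the product rule are evaluated on the surface: the derivatives
    of the components of the gradient along the frame are partial derivatives in
    the coordinates, and those of the frame produce [log_density_partial]. *)
Lemma laplacian_comp_cp y : U y ->
  laplacian (u \o cp) (phi y) = coord_laplace_beltrami phi (u \o phi) y.
Proof.
move=> Uy; have Dy := param_in_domain Uy; have Yy := chart_coord_param Uy.
rewrite (coord_laplace_beltramiE paramSphi Cu Uy) big_split /=.
have TY i a : Ck 1 D (fun x => T (Y x) i a).
  exact: (Ck_compY (Ck_frame paramSphi 1 i a)).
have E a : partial a (partial a (u \o cp)) (phi y) =
    \sum_i (frame_gradient (phi y) i * partial a (fun x => T (Y x) i a) (phi y) +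
            T y i a * partial a (frame_gradient ^~ i) (phi y)).
  rewrite (eq_partial a openD (fun x Dx => partial_comp_cp a Dx) Dy).
  have DM i := is_deriveM (Ck_is_derive a (Ck_frame_gradient i) Dy)
    (Ck_is_derive a (TY i a) Dy).
  have [_ EE] := is_derive_sum_fun DM; rewrite /partial EE.
  by apply: eq_bigr => i _; rewrite Yy.
rewrite /laplacian (eq_bigr _ (fun a _ => E a)) exchange_big /= -big_split /=.
apply: eq_bigr => i _; rewrite big_split /= addrC; congr (_ + _).
  have Eg z : U z -> coord_gradient phi f z i = ((frame_gradient ^~ i) \o phi) z.
    by move=> Uz; rewrite /= frame_gradient_param.
  rewrite (eq_partial i openU Eg Uy).
  rewrite (partial_comp i openU openD Dy Uy (Ck_frame_gradient i)); last first.
    exact: (Ck_param paramSphi 1).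
  by apply: eq_bigr => a _; rewrite (partial_param paramSphi) // mulrC.
rewrite -mulr_sumr frame_gradient_param //; congr (_ * _).
transitivity (\sum_a \sum_l \sum_m ginv y l m * (partial l (fun z => T z i a) y * T y m a)).
  apply: eq_bigr => a _.
  have -> : (fun x => T (Y x) i a) = (fun z => T z i a) \o Y by [].
  have UYy : U (Y (phi y)) by rewrite Yy.
  rewrite (partial_comp a openD openU UYy Dy (Ck_frame paramSphi 1 i a)); last first.
    exact: (Ck_chart_coord paramSphi compactS openO cpP 1).
  apply: eq_bigr => l _; rewrite Yy.
  have [_ El] := is_derive_chart_coord_entry paramSphi compactS openO cpP a l Dy.
  rewrite [X in _ * X]El Yy dist_hessian_param mulr_sumr.
  by apply: eq_bigr => m _; ring.
rewrite /log_density_partial exchange_big; apply: eq_bigr => l _ /=.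
by rewrite exchange_big; apply: eq_bigr => m _ /=; rewrite mulr_sumr.
Qed.

End LaplacianOnSurface.

(** The coordinate formula holds in every parametrization, in particular in the
    one that [laplace_beltrami] selects. *)
Lemma laplacian_closest_point (R : realType) (d k : nat) (S Omega : set 'rV[R]_d)
    (cp : 'rV[R]_d -> 'rV[R]_d) (u : 'rV[R]_d -> R) (x : 'rV[R]_d) :
  closed_surface k S -> open Omega -> S `<=` Omega ->
  closest_point_on S Omega cp -> C2_on k S u -> S x ->
  laplacian (u \o cp) x = laplace_beltrami k S u x.
Proof.
move=> [cS charts] oO SO hcp Cu Sx; rewrite /laplace_beltrami.
set P := [set c | _]; have PP : P (get P).
  have [U [phi [pU [y Uy yx]]]] := charts x Sx.
  by apply: (@getPex _ P); exists (phi, y); exists U.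
case: PP => U [pU Uc cx]; rewrite -[in LHS]cx.
exact: (laplacian_comp_cp pU cS oO SO hcp (Cu _ _ pU) Uc).
Qed.

(** On [S] the functions [v] and [v \o cp] agree. *)
Lemma C2_on_closest_point (R : realType) (d k : nat) (S Omega : set 'rV[R]_d)
    (cp : 'rV[R]_d -> 'rV[R]_d) (v : 'rV[R]_d -> R) :
  open Omega -> S `<=` Omega -> closest_point_on S Omega cp ->
  Ck 2 Omega (v \o cp) -> C2_on k S v.
Proof.
move=> oO SO hcp Cv U phi P; have oU := param_open P.
have inS y : U y -> S (phi y) by exact: (param_in_surface P).
have C : Ck 2 U ((v \o cp) \o phi).
  apply: (Ck_comp oU oO _ Cv) => [y /inS/SO//|j].
  exact: (Ck_param P).
apply: (eq_Ck oU _ C) => y Uy /=.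
by rewrite (closest_id hcp SO) //; exact: inS.
Qed.

Lemma eq_laplacian (R : realType) (n : nat) (O : set 'rV[R]_n) (f g : 'rV[R]_n -> R) x :
  open O -> (forall z, O z -> f z = g z) -> O x -> laplacian f x = laplacian g x.
Proof.
move=> oO fg Ox; apply: eq_bigr => i _; apply: (eq_partial i oO _ Ox) => z Oz.
exact: (eq_partial i oO fg Oz).
Qed.

Lemma laplacian_cst (R : realType) (n : nat) (a : R) (x : 'rV[R]_n) :
  laplacian (fun=> a) x = 0.
Proof.
apply: big1 => i _; have -> : partial i (fun=> a) = (fun=> 0) :> ('rV[R]_n -> R).
  by apply/funext => z; rewrite /partial derive_cst.
exact: derive_cst.
Qed.

Theorem theorem2 (R : realType) (d k : nat) (S Omega : set 'rV[R]_d)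
    (cp : 'rV[R]_d -> 'rV[R]_d) (eps : R) :
  closed_surface k S ->
  open Omega -> S `<=` Omega ->
  closest_point_on S Omega cp ->
  0 < eps ->
  (forall (u : 'rV[R]_d -> R) (lambda : R),
     surface_eigenfunction k S u lambda ->
     lambda < 2 * d%:R / eps ^+ 2 ->
     exists v : 'rV[R]_d -> R,
       [/\ embedded_eigenfunction Omega cp eps v lambda,
           (forall x, S x -> v x = u x),
           (forall w : 'rV[R]_d -> R,
              embedded_eigenfunction Omega cp eps w lambda ->
              (forall x, S x -> w x = u x) ->
              forall x, Omega x -> w x = v x) &
           (forall x, Omega x ->
              v x = (laplacian (u \o cp) x + 2 * d%:R / eps ^+ 2 * u (cp x))
                    / (- lambda + 2 * d%:R / eps ^+ 2))]) /\
  (forall (v : 'rV[R]_d -> R) (lambda : R),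
     embedded_eigenfunction Omega cp eps v lambda ->
     surface_solution k S v lambda /\
     (lambda != 2 * d%:R / eps ^+ 2 -> surface_eigenfunction k S v lambda)).
Proof.
move=> surfS oO SO hcp eps0; set c := 2 * d%:R / eps ^+ 2.
have cpS x : Omega x -> S (cp x) by case/hcp.
have cpid := closest_id hcp SO.
split=> [u lambda [[Cu eqn] [x0 Sx0 ux0]] lc | v lambda [Cv eqn [x0 Ox0 vx0]]].
  have cl0 : - lambda + c != 0 by rewrite gt_eqF // addrC subr_gt0.
  pose v x := (laplacian (u \o cp) x + c * u (cp x)) / (- lambda + c).
  have vu x : S x -> v x = u x.
    move=> Sx; rewrite /v (laplacian_closest_point surfS oO SO hcp Cu Sx) cpid //.
    have := eqn x Sx => /eqP; rewrite eqr_oppLR => /eqP ->.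
    by rewrite -mulNr -mulrDl mulrAC divff // mul1r.
  have vcp (w : 'rV[R]_d -> R) : (forall x, S x -> w x = u x) ->
      forall x, Omega x -> (u \o cp) x = (w \o cp) x.
    by move=> wu x Ox; rewrite /= wu //; exact: cpS.
  exists v; split => //.
  - split.
    + exact: eq_Ck (vcp v vu) (C2_comp_closest_point surfS oO hcp Cu).
    + move=> x Ox; rewrite /sharp_laplacian -/c -(eq_laplacian oO (vcp v vu) Ox).
      have -> : v (cp x) = u (cp x) by apply: vu; exact: cpS.
      have : v x * (- lambda + c) = laplacian (u \o cp) x + c * u (cp x) by rewrite divfK.
      lra.
    + by exists x0; [exact: SO|rewrite vu].
  - move=> w [Cw weqn _] wu x Ox; apply: (mulIf cl0); rewrite [RHS]divfK //.
    have := weqn x Ox; rewrite /sharp_laplacian -/c -(eq_laplacian oO (vcp w wu) Ox).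
    have -> : w (cp x) = u (cp x) by apply: wu; exact: cpS.
    lra.
have C2v : C2_on k S v := C2_on_closest_point oO SO hcp Cv.
have sol : surface_solution k S v lambda.
  split=> // x Sx; rewrite -(laplacian_closest_point surfS oO SO hcp C2v Sx).
  by have := eqn x (SO x Sx); rewrite /sharp_laplacian cpid // subrr mulr0 subr0.
split=> // lc; split=> //; apply: contrapT => nv.
have v0 x : S x -> v x = 0.
  by move=> Sx; apply: contrapT => /eqP vx; apply: nv; exists x.
have vcp0 x : Omega x -> (v \o cp) x = 0 by move=> Ox; apply: v0; exact: cpS.
have := eqn x0 Ox0; rewrite /sharp_laplacian -/c.
have -> : v (cp x0) = 0 by exact: vcp0.
rewrite (eq_laplacian oO vcp0 Ox0) laplacian_cst sub0r opprK subr0 => /eqP.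
by rewrite -subr_eq0 -mulrBl mulf_eq0 subr_eq0 eq_sym (negbTE lc) (negbTE vx0).
Qed.
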